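(* Let $(\mathcal K,(\cdot,\cdot)_E,[\cdot,\cdot]_{\mathcal K},\rho)$ be an $E$-Courant algebroid that has a decomposition $\mathcal K=A\oplus B$, where $A$ and $B$ are transverse Dirac structures. Then $(A,B)$ is an $E$-Lie bialgebroid, where $A$ and $B$ are mutually $E$-dual via $\langle X,\xi\rangle_E=2(X,\xi)_E$ ($X\in A$, $\xi\in B$), carry the Lie algebroid structures given by restricting $[\cdot,\cdot]_{\mathcal K}$ with anchors $j\circ\rho|_A$ and $j\circ\rho|_B$, and the representations on $E$ are $\rho_A=\rho|_A$ and $\rho_B=\rho|_B$.
   Context: **Bundles.** $\mathfrak DE$ is the gauge Lie algebroid of $E\to M$: its sections are the $\mathbb R$-linear $\mathfrak d:\Gamma(E)\to\Gamma(E)$ for which there is a vector field $j(\mathfrak d)$ with $\mathfrak d(fu)=f\mathfrak d(u)+j(\mathfrak d)(f)u$; bracket $[\cdot,\cdot]_{\mathfrak D}$ = commutator, anchor $j$. The first jet bundle $\mathfrak JE$ is regarded as $\{\nu\in\mathrm{Hom}(\mathfrak DE,E):\nu(\Psi)=\Psi(\nu(\mathrm{Id}_E))\ \forall\Psi\in\mathfrak{gl}(E)\}$, the jet $[u]_m$ corresponding to $\mathfrak d\mapsto\mathfrak d(u)(m)$; $\mathbf d:\Gamma(E)\to\Gamma(\mathfrak JE)$, $(\mathbf du)(\mathfrak d)=\mathfrak d(u)$. **$E$-Courant algebroids.** A Leibniz algebra has a bilinear bracket with $[g_1,[g_2,g_3]]=[[g_1,g_2],g_3]+[g_2,[g_1,g_3]]$.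 An $E$-Courant algebroid is $(\mathcal K,(\cdot,\cdot)_E,[\cdot,\cdot]_{\mathcal K},\rho)$: $\mathcal K\to M$ a vector bundle with $(\Gamma(\mathcal K),[\cdot,\cdot]_{\mathcal K})$ a Leibniz algebra over $\mathbb R$; $(\cdot,\cdot)_E:\mathcal K\otimes\mathcal K\to E$ symmetric nondegenerate; $\rho:\mathcal K\to\mathfrak DE$ a bundle map; with $\rho^\star(\nu)(k)=\nu(\rho(k))$, for all sections: (EC-1) $\rho[X,Y]_{\mathcal K}=[\rho(X),\rho(Y)]_{\mathfrak D}$; (EC-2) $[X,X]_{\mathcal K}=\rho^\star\mathbf d(X,X)_E$; (EC-3) $\rho(X)(Y,Z)_E=([X,Y]_{\mathcal K},Z)_E+(Y,[X,Z]_{\mathcal K})_E$; (EC-4) $\rho^\star(\mathfrak JE)\subset\mathcal K$, where $\rho^\star(\mu)$ is identified with the element of $\mathcal K$ satisfying $(\rho^\star(\mu),X)_E=\tfrac12\mu(\rho(X))$; (EC-5) $\rho\circ\rho^\star=0$ on $\mathfrak JE$. A Dirac structure is a subbundle $L\subset\mathcal K$ closed under the bracket with $L=L^\perp:=\{e\in\mathcal K:(e,l)_E=0\ \forall l\in L\}$; a Dirac structure is a Lie algebroid with the restricted bracket and anchor $j\circ\rho|_L$, and $\rho|_L$ is a representation on $E$. **$E$-duality.** $B$ is an $E$-dual bundle of $A$ if $B\subset\mathrm{Hom}(A,E)$ is a subbundle and the pairing $\langle a,b\rangle_E=b(a)$ is nondegenerate (on both sides); then also $A\subset\mathrm{Hom}(B,E)$.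 Set $\mathrm{Hom}(\wedge^0A,E)_B=E$, $\mathrm{Hom}(\wedge^1A,E)_B=B$, and for $k\ge2$ let $\mathrm{Hom}(\wedge^kA,E)_B$ consist of the $\mu\in\mathrm{Hom}(\wedge^kA,E)$ with $\mu(X_1,\dots,X_{k-1},\cdot)\in B$ for all $X_i$; similarly $\mathrm{Hom}(\wedge^kB,E)_A$. If $A$ is a Lie algebroid with representation $\rho_A:A\to\mathfrak DE$, $d^A$ is the Chevalley–Eilenberg coboundary on $\Gamma(\mathrm{Hom}(\wedge^\bullet A,E))$; $\rho_A$ is $B$-invariant if $\Gamma(\mathrm{Hom}(\wedge^\bullet A,E)_B)$ is a subcomplex. An $E$-dual pair of Lie algebroids $((A,\rho_A);(B,\rho_B))$ consists of Lie algebroids $A,B$ that are mutually $E$-dual, a $B$-invariant representation $\rho_A:A\to\mathfrak DE$ and an $A$-invariant representation $\rho_B:B\to\mathfrak DE$. **Lie derivatives.** For $X,Y\in\Gamma(A)$, $\xi\in\Gamma(B)$: $\mathcal L_Xu=\rho_A(X)u$, $\mathcal L_XY=[X,Y]$, $\langle\mathcal L_X\xi,Y\rangle_E=\rho_A(X)\langle\xi,Y\rangle_E-\langle\xi,[X,Y]\rangle_E$, and for $\Xi\in\Gamma(\mathrm{Hom}(\wedge^kB,E)_A)$, $(\mathcal L_X\Xi)(\xi_1,\dots,\xi_k)=\rho_A(X)(\Xi(\xi_1,\dots,\xi_k))-\sum_i\Xi(\xi_1,\dots,\mathcal L_X\xi_i,\dots,\xi_k)$; analogously for $\mathcal L_\xi$,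 exchanging $A$ and $B$. **$E$-Lie bialgebroid.** An $E$-dual pair such that for all $X,Y\in\Gamma(A)$, $u\in\Gamma(E)$: (1) $d^B[X,Y]=\mathcal L_X(d^BY)-\mathcal L_Y(d^BX)$; (2) $\mathcal L_{d^Au}X=-\mathcal L_{d^Bu}X$; (3) $\langle d^Bu,d^Au\rangle_E=0$. (Here $d^Au\in\Gamma(B)$, $d^Bu\in\Gamma(A)$.) *)

(* Defs.v *)
From HB Require Import structures.
From mathcomp Require Import all_boot all_order all_algebra.
From mathcomp Require Import all_classical all_reals.
From mathcomp Require Import topology normedtype landau derive.
Set Implicit Arguments.
Unset Strict Implicit.
Unset Printing Implicit Defensive.
Import Order.TTheory GRing.Theory Num.Theory.
Import numFieldNormedType.Exports.
Local Open Scope classical_set_scope.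
Local Open Scope ring_scope.

Lemma near_eq_differentiable (R : realType) (V W : normedModType R)
    (f g : V -> W) (x : V) :
  (\forall y \near x, f y = g y) -> differentiable f x -> differentiable g x.
Proof.
move=> fg /diff_locallyP [dc dfx].
have fgx : f x = g x by exact: nbhs_singleton fg.
have H : g \o shift x = cst (g x) + 'd f x +o_ 0 id.
  apply/eqaddoP; move/eqaddoP : dfx => dfx e e0.
  have := dfx e e0.
  have : \forall y \near (0 : V), f (y + x) = g (y + x).
    by move: fg; rewrite (near_shift 0) /=; apply: filterS => y /=; rewrite subr0.
  apply: filterS2 => y /= fgy.
  by rewrite !fctE /= -fgy -fgx.
apply/diff_locallyP.
have E : 'd g x = 'd f x :> (_ -> _) by apply: diff_unique.
by rewrite E.
Qed.

Section SmoothFunctionsRn.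
Context {R : realType} {n : nat}.
Implicit Types (U V : set 'rV[R]_n) (f g : 'rV[R]_n -> R) (k : nat).

(* Functions of class C^k on an open set U; values outside U are irrelevant. *)
Fixpoint Ck k U f : Prop :=
  match k with
  | 0 => forall x, U x -> {for x, continuous f}
  | k'.+1 => (forall x, U x -> differentiable f x) /\
             forall i : 'I_n, Ck k' U (fun x => 'D_(delta_mx 0 i) f x)
  end.

Definition Cinfty U f := forall k, Ck k U f.

Lemma Ck_ext k U f g : open U -> (forall x, U x -> f x = g x) ->
  Ck k U f -> Ck k U g.
Proof.
move=> oU; have nU (x : 'rV[R]_n) : U x -> \forall y \near x, U y by move=> Ux; exact: open_nbhs_nbhs.
have nfg (f' g' : 'rV[R]_n -> R) x : (forall x, U x -> f' x = g' x) -> U x ->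
   \forall y \near x, f' y = g' y.
  by move=> e Ux; apply: filterS (nU x Ux) => y; exact: e.
elim: k f g => [|k IH] f g fg /=.
  move=> cf x Ux; have cfx := cf x Ux.
  rewrite /prop_for /continuous_at -fg //; apply: cvg_trans cfx.
  by apply: (@near_eq_cvg _ _ (nbhs x)); apply: nfg fg Ux.
move=> [df Hd]; split=> [x Ux|i].
  exact: near_eq_differentiable (nfg _ _ _ fg Ux) (df x Ux).
apply: IH (Hd i) => x Ux; exact: near_eq_derive (nfg _ _ _ fg Ux).
Qed.

Lemma CkS k U f : Ck k.+1 U f -> Ck k U f.
Proof.
elim: k f => [|k IH] f /= [df Hd]; first by move=> x /df /differentiable_continuous.
by split=> // i; apply: IH.
Qed.

Lemma Ck_sub k U V f : V `<=` U -> Ck k U f -> Ck k V f.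
Proof.
move=> VU; elim: k f => [|k IH] f /=; first by move=> cf x /VU/cf.
by move=> [df Hd]; split=> [x /VU/df//|i]; apply: IH.
Qed.

Lemma Ck_local k U f :
  (forall x, U x -> exists2 V, V x & Ck k V f) -> Ck k U f.
Proof.
elim: k f => [|k IH] f /= H.
  by move=> x Ux; have [V Vx /(_ x Vx)] := H x Ux.
split=> [x Ux|i]; first by have [V Vx [/(_ x Vx)]] := H x Ux.
by apply: IH => x Ux; have [V Vx [_ /(_ i)]] := H x Ux; exists V.
Qed.

Lemma Ck_cst k U (a : R) : Ck k U (fun=> a).
Proof.
elim: k a => [|k IH] a /=; first by move=> x _; exact: cst_continuous.
split=> [x _|i]; first exact: differentiable_cst.
have -> : (fun x : 'rV[R]_n => 'D_(delta_mx 0 i) (fun=> a) x) = (fun=> 0 : R).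
  by apply/funext => x; rewrite derive_cst.
exact: IH.
Qed.

Lemma CkD k U f g : open U -> Ck k U f -> Ck k U g ->
  Ck k U (fun x => f x + g x).
Proof.
move=> oU; elim: k f g => [|k IH] f g /=.
  by move=> cf cg x Ux; apply: continuousD; [exact: cf|exact: cg].
move=> [df Hf] [dg Hg]; split=> [x Ux|i].
  by apply: differentiableD; [exact: df|exact: dg].
apply: Ck_ext (IH _ _ (Hf i) (Hg i)) => // x Ux.
by rewrite -deriveD //; apply: diff_derivable; [exact: df|exact: dg].
Qed.

Lemma CkM k U f g : open U -> Ck k U f -> Ck k U g ->
  Ck k U (fun x => f x * g x).
Proof.
move=> oU; elim: k f g => [|k IH] f g.
  by move=> cf cg x Ux; apply: continuousM; [exact: cf|exact: cg].
move=> /[dup] /CkS cf [df Hf] /[dup] /CkS cg [dg Hg]; split=> [x Ux|i].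
  by apply: differentiableM; [exact: df|exact: dg].
have C := CkD oU (IH _ _ cf (Hg i)) (IH _ _ cg (Hf i)).
apply: Ck_ext C => // x Ux; rewrite -[RHS]/('D_(delta_mx 0 i) (f * g) x) deriveM//.
  by apply: diff_derivable; exact: df.
by apply: diff_derivable; exact: dg.
Qed.

Lemma CkV k U f : open U -> (forall x, U x -> f x != 0) -> Ck k U f ->
  Ck k U (fun x => (f x)^-1).
Proof.
move=> oU f0; elim: k => [|k IH].
  by move=> cf x Ux; apply: continuousV; [exact: f0|exact: cf].
move=> /[dup] /CkS /IH cf [df Hf]; split=> [x Ux|i].
  by apply: differentiableV; [exact: df|exact: f0].
have C := CkM oU (Ck_cst k U (-1)) (CkM oU (CkM oU cf cf) (Hf i)).
apply: Ck_ext C => // x Ux; rewrite deriveV ?f0//; last exact/diff_derivable/df.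
by rewrite mulN1r expr2 invfM scaleNr.
Qed.

Lemma Cinfty_ext U f g : open U -> (forall x, U x -> f x = g x) ->
  Cinfty U f -> Cinfty U g.
Proof. by move=> oU fg cf k; exact: Ck_ext (cf k). Qed.

Lemma Cinfty_sub U V f : V `<=` U -> Cinfty U f -> Cinfty V f.
Proof. by move=> VU cf k; exact: Ck_sub (cf k). Qed.

Lemma Cinfty_local U f :
  (forall x, U x -> exists2 V, V x & Cinfty V f) -> Cinfty U f.
Proof.
by move=> H k; apply: Ck_local => x /H[V Vx cV]; exists V => //; exact: cV.
Qed.

Lemma Cinfty_cst U (a : R) : Cinfty U (fun=> a).
Proof. by move=> k; exact: Ck_cst. Qed.

Lemma CinftyD U f g : open U -> Cinfty U f -> Cinfty U g ->
  Cinfty U (fun x => f x + g x).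
Proof. by move=> oU cf cg k; exact: CkD. Qed.

Lemma CinftyM U f g : open U -> Cinfty U f -> Cinfty U g ->
  Cinfty U (fun x => f x * g x).
Proof. by move=> oU cf cg k; exact: CkM. Qed.

Lemma CinftyV U f : open U -> (forall x, U x -> f x != 0) -> Cinfty U f ->
  Cinfty U (fun x => (f x)^-1).
Proof. by move=> oU f0 cf k; exact: CkV. Qed.

End SmoothFunctionsRn.

(* A smooth manifold of dimension n: Hausdorff, second countable, with a smooth
   atlas.  [mchart i] is a homeomorphism from [mdom i] onto its open image, with
   inverse [mparam i]; both are total functions, only meaningful there.  The
   atlas need not be maximal. *)
Record manifold (R : realType) (n : nat) := Manifold {
  mpoint :> topologicalType;
  mhausdorff : hausdorff_space mpoint;
  msecond_countable : @second_countable mpoint;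
  mindex : Type;
  mdom : mindex -> set mpoint;
  mchart : mindex -> mpoint -> 'rV[R]_n;
  mparam : mindex -> 'rV[R]_n -> mpoint;
  mdom_open : forall i, open (mdom i);
  mdom_cover : forall x, exists i, mdom i x;
  mimage_open : forall i, open (mchart i @` mdom i);
  mchartK : forall i x, mdom i x -> mparam i (mchart i x) = x;
  mchart_continuous : forall i x, mdom i x -> {for x, continuous (mchart i)};
  mparam_continuous : forall i y, (mchart i @` mdom i) y ->
    {for y, continuous (mparam i)};
  mtransition : forall i j (c : 'I_n),
    Cinfty (mchart i @` (mdom i `&` mdom j))
      (fun y => mchart j (mparam i y) 0 c) }.

Section SmoothFunctions.
Context {R : realType} {n : nat} {M : manifold R n}.
Implicit Types (U V : set M) (f g : M -> R).

Definition smooth_on U f := forall i : mindex M,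
  Cinfty (mchart i @` (mdom i `&` U)) (f \o mparam i).

Lemma mchart_open (i : mindex M) U : open U -> open (mchart i @` (mdom i `&` U)).
Proof.
move=> oU.
have -> : mchart i @` (mdom i `&` U) =
    (mchart i @` mdom i) `&` (@mparam _ _ M i @^-1` U).
  apply/seteqP; split=> [_ [x [ix Ux] <-]|y [[x ix <-]] /=].
    by split; [exists x|rewrite /= mchartK].
  by rewrite mchartK // => Ux; exists x.
rewrite openE => y [iy Uy]; apply: filterI.
  by apply: open_nbhs_nbhs; split=> //; exact: mimage_open.
by apply: (mparam_continuous iy); apply: open_nbhs_nbhs.
Qed.

Lemma smooth_on_ext U f g : open U -> (forall x, U x -> f x = g x) ->
  smooth_on U f -> smooth_on U g.
Proof.
move=> oU fg sf i; apply: Cinfty_ext (sf i); first exact: mchart_open.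
by move=> _ [x [ix Ux] <-] /=; rewrite mchartK // fg.
Qed.

Lemma smooth_on_sub U V f : V `<=` U -> smooth_on U f -> smooth_on V f.
Proof.
move=> VU sf i; apply: Cinfty_sub (sf i).
by apply: image_subset; exact: setIS.
Qed.

Lemma smooth_on_local U f :
  (forall x, U x -> exists2 V, V x & smooth_on V f) -> smooth_on U f.
Proof.
move=> H i; apply: Cinfty_local => _ [x [ix Ux] <-].
have [V Vx sf] := H x Ux; exists (mchart i @` (mdom i `&` V)); last exact: sf.
by exists x.
Qed.

Lemma smooth_on_cst U (a : R) : smooth_on U (fun=> a).
Proof. by move=> i; exact: Cinfty_cst. Qed.

Lemma smooth_onD U f g : open U -> smooth_on U f -> smooth_on U g ->
  smooth_on U (fun x => f x + g x).
Proof. by move=> oU sf sg i; exact: (@CinftyD _ _ _ (f \o mparam i) (g \o mparam i)) (mchart_open oU) (sf i) (sg i). Qed.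

Lemma smooth_onM U f g : open U -> smooth_on U f -> smooth_on U g ->
  smooth_on U (fun x => f x * g x).
Proof. by move=> oU sf sg i; exact: (@CinftyM _ _ _ (f \o mparam i) (g \o mparam i)) (mchart_open oU) (sf i) (sg i). Qed.

Lemma smooth_onN U f : open U -> smooth_on U f -> smooth_on U (fun x => - f x).
Proof.
move=> oU sf; apply: smooth_on_ext (smooth_onM oU (smooth_on_cst U (-1)) sf) => //.
by move=> x _; rewrite mulN1r.
Qed.

Lemma smooth_onV U f : open U -> (forall x, U x -> f x != 0) ->
  smooth_on U f -> smooth_on U (fun x => (f x)^-1).
Proof.
move=> oU f0 sf i; apply: (@CinftyV _ _ _ (f \o mparam i)) (mchart_open oU) _ (sf i).
by move=> _ [x [ix Ux] <-] /=; rewrite mchartK //; exact: f0.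
Qed.

Lemma smooth_on_sum U (I : Type) (r : seq I) (F : I -> M -> R) : open U ->
  (forall i, smooth_on U (F i)) -> smooth_on U (fun x => \sum_(i <- r) F i x).
Proof.
move=> oU sF; elim: r => [|i r IH].
  by apply: smooth_on_ext (smooth_on_cst U 0) => // x _; rewrite big_nil.
apply: smooth_on_ext (smooth_onD oU (sF i) IH) => // x _.
by rewrite big_cons.
Qed.

Lemma smooth_on_prod U (I : Type) (r : seq I) (F : I -> M -> R) : open U ->
  (forall i, smooth_on U (F i)) -> smooth_on U (fun x => \prod_(i <- r) F i x).
Proof.
move=> oU sF; elim: r => [|i r IH].
  by apply: smooth_on_ext (smooth_on_cst U 1) => // x _; rewrite big_nil.
apply: smooth_on_ext (smooth_onM oU (sF i) IH) => // x _.
by rewrite big_cons.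
Qed.

Lemma smooth_on_det U k (A : M -> 'M[R]_k) : open U ->
  (forall i j, smooth_on U (fun x => A x i j)) ->
  smooth_on U (fun x => \det (A x)).
Proof.
move=> oU sA; apply: smooth_on_sum => // s.
apply: smooth_onM => //; first exact: smooth_on_cst.
by apply: smooth_on_prod => // i; exact: sA.
Qed.

Lemma smooth_on_mulmx U k l p (A : M -> 'M[R]_(k, l)) (B : M -> 'M[R]_(l, p)) :
  open U -> (forall i j, smooth_on U (fun x => A x i j)) ->
  (forall i j, smooth_on U (fun x => B x i j)) ->
  forall i j, smooth_on U (fun x => (A x *m B x) i j).
Proof.
move=> oU sA sB i j.
have : smooth_on U (fun x => \sum_l A x i l * B x l j).
  by apply: smooth_on_sum => // l'; exact: smooth_onM.
by apply: smooth_on_ext => // x _; rewrite mxE.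
Qed.

Lemma smooth_on_invmx U k (A : M -> 'M[R]_k) : open U ->
  (forall x, U x -> A x \in unitmx) ->
  (forall i j, smooth_on U (fun x => A x i j)) ->
  forall i j, smooth_on U (fun x => invmx (A x) i j).
Proof.
move=> oU uA sA i j.
have sadj : smooth_on U (fun x => (\adj (A x)) i j).
  have : smooth_on U (fun x => cofactor (A x) j i).
    apply: smooth_onM => //; first exact: smooth_on_cst.
    apply: smooth_on_det => // i' j'.
    by apply: smooth_on_ext (sA (lift j i') (lift i j')) => // x _; rewrite !mxE.
  by apply: smooth_on_ext => // x _; rewrite mxE.
have sdet : smooth_on U (fun x => (\det (A x))^-1).
  apply: smooth_onV; [by []| |exact: smooth_on_det].
  by move=> x Ux; rewrite -unitfE -unitmxE uA.
apply: smooth_on_ext (smooth_onM oU sdet sadj) => // x Ux.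
by rewrite /invmx uA // [RHS]mxE.
Qed.

End SmoothFunctions.

Section SmoothFunctionRing.
Context {R : realType} {n : nat} (M : manifold R n).

Definition smooth_pred : {pred M -> R} := mem [set f : M -> R | smooth_on setT f].

Lemma smooth_predP (f : M -> R) : (f \in smooth_pred) <-> smooth_on setT f.
Proof. by split; rewrite inE. Qed.

Lemma smooth_pred_subring : subring_closed smooth_pred.
Proof.
split=> [|f g /smooth_predP sf /smooth_predP sg|f g /smooth_predP sf /smooth_predP sg];
  apply/smooth_predP.
- exact: smooth_on_cst.
- by apply: smooth_onD; [exact: openT| |apply: smooth_onN => //; exact: openT].
- by apply: smooth_onM => //; exact: openT.
Qed.

(* The ring of smooth functions on M. *)
Record smooth_fun := SmoothFun {
  smooth_val :> M -> R; _ : smooth_val \in smooth_pred }.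
HB.instance Definition _ := [isSub for smooth_val].
HB.instance Definition _ := [Choice of smooth_fun by <:].
HB.instance Definition _ := GRing.SubChoice_isSubComPzRing.Build
  (M -> R) smooth_pred smooth_fun smooth_pred_subring.

Lemma smooth_funP (f : smooth_fun) : smooth_on setT f.
Proof. exact/smooth_predP/(valP f). Qed.

Definition mk_smooth_fun (f : M -> R) (sf : smooth_on setT f) : smooth_fun :=
  SmoothFun ((smooth_predP f).2 sf).

Definition smooth_cst (a : R) : smooth_fun :=
  mk_smooth_fun (smooth_on_cst setT a).

End SmoothFunctionRing.

(* A smooth real vector bundle of rank [vrank], given by its fibres and a cover of
   M by local frames (equivalently, local trivializations) whose transition
   matrices are smooth. *)
Record vbundle (R : realType) (n : nat) (M : manifold R n) := VBundle {
  vrank : nat;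
  vfib :> M -> vectType R;
  vindex : Type;
  vdom : vindex -> set M;
  vframe : vindex -> forall m, vrank.-tuple (vfib m);
  vdom_open : forall j, open (vdom j);
  vdom_cover : forall m, exists j, vdom j m;
  vframe_basis : forall j m, vdom j m -> basis_of fullv (vframe j m);
  vtransition : forall j k (a b : 'I_vrank),
    smooth_on (vdom j `&` vdom k)
      (fun m => coord (vframe j m) a (tnth (vframe k m) b)) }.

Section Sections.
Context {R : realType} {n : nat} {M : manifold R n}.
Implicit Types (U : set M).

Definition smooth_sec (E : vbundle M) U (s : forall m, E m) :=
  forall (j : vindex E) (a : 'I_(vrank E)),
    smooth_on (vdom j `&` U) (fun m => coord (vframe j m) a (s m)).

Lemma frame_sum (E : vbundle M) (j : vindex E) m (v : E m) : vdom j m ->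
  v = \sum_b coord (vframe j m) b v *: tnth (vframe j m) b.
Proof.
move=> jm; rewrite {1}(coord_basis (vframe_basis jm) (memvf v)).
by apply: eq_bigr => b _; rewrite (tnth_nth 0).
Qed.

Lemma smooth_sec_local (E : vbundle M) U (s : forall m, E m) : open U ->
  (forall m, U m -> exists V (j : vindex E), [/\ open V, V m, vdom j m &
     forall a, smooth_on (V `&` vdom j) (fun m => coord (vframe j m) a (s m))]) ->
  smooth_sec U s.
Proof.
move=> oU H k a; apply: smooth_on_local => m [km Um].
have [V [j [oV Vm jm sj]]] := H m Um.
exists (V `&` (vdom j `&` vdom k)); first by split.
have oW : open (V `&` (vdom j `&` vdom k)).
  by apply: openI => //; apply: openI; exact: vdom_open.
have : smooth_on (V `&` (vdom j `&` vdom k)) (fun m =>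
    \sum_b coord (vframe j m) b (s m) * coord (vframe k m) a (tnth (vframe j m) b)).
  apply: smooth_on_sum => // b; apply: smooth_onM => //.
    by apply: smooth_on_sub (sj b) => x [Vx [jx kx]].
  by apply: smooth_on_sub (vtransition k j a b) => x [Vx [jx kx]].
apply: smooth_on_ext => // x [Vx [jx kx]].
rewrite [in RHS](frame_sum (s x) jx) linear_sum /=.
by apply: eq_bigr => b _; rewrite linearZ.
Qed.

Lemma smooth_sec_sub (E : vbundle M) U V (s : forall m, E m) :
  V `<=` U -> smooth_sec U s -> smooth_sec V s.
Proof. by move=> VU ss j a; apply: smooth_on_sub (ss j a); exact: setIS. Qed.

Lemma smooth_sec0 (E : vbundle M) U : open U -> smooth_sec U (fun m => 0 : E m).
Proof.
move=> oU j a; have oW : open (vdom j `&` U) by apply: openI => //; exact: vdom_open.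
by apply: smooth_on_ext (smooth_on_cst _ 0) => // x _; rewrite linear0.
Qed.

Lemma smooth_secD (E : vbundle M) U (s t : forall m, E m) : open U ->
  smooth_sec U s -> smooth_sec U t -> smooth_sec U (fun m => s m + t m).
Proof.
move=> oU ss st j a.
have oW : open (vdom j `&` U) by apply: openI => //; exact: vdom_open.
by apply: smooth_on_ext (smooth_onD oW (ss j a) (st j a)) => // x _; rewrite linearD.
Qed.

Lemma smooth_secZ (E : vbundle M) U (f : M -> R) (s : forall m, E m) : open U ->
  smooth_on U f -> smooth_sec U s -> smooth_sec U (fun m => f m *: s m).
Proof.
move=> oU sf ss j a.
have oW : open (vdom j `&` U) by apply: openI => //; exact: vdom_open.
have sf' : smooth_on (vdom j `&` U) f by apply: smooth_on_sub sf => x [].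
by apply: smooth_on_ext (smooth_onM oW sf' (ss j a)) => // x _; rewrite linearZ.
Qed.

Lemma smooth_secN (E : vbundle M) U (s : forall m, E m) : open U ->
  smooth_sec U s -> smooth_sec U (fun m => - s m).
Proof.
move=> oU ss j a.
have oW : open (vdom j `&` U) by apply: openI => //; exact: vdom_open.
by apply: smooth_on_ext (smooth_onN oW (ss j a)) => // x _; rewrite linearN.
Qed.

End Sections.

Section SectionModule.
Context {R : realType} {n : nat} {M : manifold R n} (E : vbundle M).

Record section := MkSection {
  section_val :> forall m, E m;
  section_smooth : smooth_sec setT section_val }.

Lemma section_ext (s t : section) : (forall m, s m = t m) -> s = t.
Proof.
case: s t => [s ss] [t st] /= st'.
have {}st' : s = t by apply: functional_extensionality_dep.
by subst t; congr MkSection; exact: Prop_irrelevance.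
Qed.

HB.instance Definition _ := gen_eqMixin section.
HB.instance Definition _ := gen_choiceMixin section.

Let T0 : open [set: M] := openT.

Definition section0 : section := MkSection (smooth_sec0 (E := E) T0).
Definition sectionD (s t : section) : section :=
  MkSection (smooth_secD T0 (section_smooth s) (section_smooth t)).
Definition sectionN (s : section) : section :=
  MkSection (smooth_secN T0 (section_smooth s)).
Definition sectionZ (f : smooth_fun M) (s : section) : section :=
  MkSection (smooth_secZ T0 (smooth_funP f) (section_smooth s)).

Fact sectionDA : associative sectionD.
Proof. by move=> s t u; apply: section_ext => m /=; rewrite addrA. Qed.
Fact sectionDC : commutative sectionD.
Proof. by move=> s t; apply: section_ext => m /=; rewrite addrC. Qed.
Fact section0D : left_id section0 sectionD.
Proof. by move=> s; apply: section_ext => m /=; rewrite add0r. Qed.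
Fact sectionND : left_inverse section0 sectionN sectionD.
Proof. by move=> s; apply: section_ext => m /=; rewrite addNr. Qed.

HB.instance Definition _ :=
  GRing.isZmodule.Build section sectionDA sectionDC section0D sectionND.

Fact sectionZA (f g : smooth_fun M) (s : section) :
  sectionZ f (sectionZ g s) = sectionZ (f * g) s.
Proof. by apply: section_ext => m /=; rewrite scalerA. Qed.
Fact sectionZ1 : left_id 1 sectionZ.
Proof. by move=> s; apply: section_ext => m /=; rewrite scale1r. Qed.
Fact sectionZDr : right_distributive sectionZ +%R.
Proof. by move=> f s t; apply: section_ext => m /=; rewrite scalerDr. Qed.
Fact sectionZDl (s : section) :
  {morph (fun f : smooth_fun M => sectionZ f s) : f g / f + g}.
Proof. by move=> f g; apply: section_ext => m /=; rewrite scalerDl. Qed.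

HB.instance Definition _ := GRing.Zmodule_isLmodule.Build (smooth_fun M) section
  sectionZA sectionZ1 sectionZDr sectionZDl.

End SectionModule.

Lemma comm_cancel (V : zmodType) (a b c d e h : V) :
  a + b + (c + d) - (e + c + (b + h)) = a - e + (d - h).
Proof.
have -> : a + b + (c + d) = a + d + (b + c) by rewrite [c + d]addrC addrACA.
have -> : e + c + (b + h) = e + h + (b + c).
  by rewrite [b + h]addrC addrACA [c + b]addrC.
by rewrite [- (_ + (b + c))]opprD addrACA subrr addr0 opprD addrACA.
Qed.

Section VectorFields.
Context {R : realType} {n : nat} (M : manifold R n).

(* Vector fields on M, as R-linear derivations of the ring of smooth functions. *)
Record vfield := VField {
  vf :> smooth_fun M -> smooth_fun M;
  vf_linear : forall (a : R) f g,
    vf (smooth_cst M a * f + g) = smooth_cst M a * vf f + vf g;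
  vf_leibniz : forall f g, vf (f * g) = vf f * g + f * vf g }.

Lemma vfield_ext (X Y : vfield) : (forall f, X f = Y f) -> X = Y.
Proof.
case: X Y => [X X1 X2] [Y Y1 Y2] /= XY.
have {}XY : X = Y by exact/funext.
by subst Y; congr VField; exact: Prop_irrelevance.
Qed.

Lemma vfD (X : vfield) f g : X (f + g) = X f + X g.
Proof.
have := vf_linear X 1 f g.
have -> : smooth_cst M 1 = 1 by exact: val_inj.
by rewrite !mul1r.
Qed.

Lemma vf0 (X : vfield) : X 0 = 0.
Proof. by apply: (addrI (X 0)); rewrite -vfD !addr0. Qed.

Lemma vfN (X : vfield) f : X (- f) = - X f.
Proof. by apply: (addrI (X f)); rewrite -vfD !subrr vf0. Qed.

Lemma vfB (X : vfield) f g : X (f - g) = X f - X g.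
Proof. by rewrite vfD vfN. Qed.

Lemma vf_cst_mul (X : vfield) a f : X (smooth_cst M a * f) = smooth_cst M a * X f.
Proof. by have := vf_linear X a f 0; rewrite vf0 !addr0. Qed.

HB.instance Definition _ := gen_eqMixin vfield.
HB.instance Definition _ := gen_choiceMixin vfield.

Fact vfield0_linear (a : R) (f g : smooth_fun M) :
  0 = smooth_cst M a * 0 + 0 :> smooth_fun M.
Proof. by rewrite mulr0 addr0. Qed.
Fact vfield0_leibniz (f g : smooth_fun M) : 0 = 0 * g + f * 0 :> smooth_fun M.
Proof. by rewrite mulr0 mul0r addr0. Qed.
Definition vfield0 : vfield := VField vfield0_linear vfield0_leibniz.

Fact vfieldD_linear (X Y : vfield) (a : R) f g :
  X (smooth_cst M a * f + g) + Y (smooth_cst M a * f + g) =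
  smooth_cst M a * (X f + Y f) + (X g + Y g).
Proof. by rewrite !vf_linear mulrDr addrACA. Qed.
Fact vfieldD_leibniz (X Y : vfield) f g :
  X (f * g) + Y (f * g) = (X f + Y f) * g + f * (X g + Y g).
Proof. by rewrite !vf_leibniz mulrDl mulrDr addrACA. Qed.
Definition vfieldD (X Y : vfield) : vfield :=
  VField (vfieldD_linear X Y) (vfieldD_leibniz X Y).

Fact vfieldN_linear (X : vfield) (a : R) f g :
  - X (smooth_cst M a * f + g) = smooth_cst M a * - X f + - X g.
Proof. by rewrite vf_linear opprD mulrN. Qed.
Fact vfieldN_leibniz (X : vfield) f g : - X (f * g) = - X f * g + f * - X g.
Proof. by rewrite vf_leibniz opprD mulrN mulNr. Qed.
Definition vfieldN (X : vfield) : vfield :=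
  VField (vfieldN_linear X) (vfieldN_leibniz X).

Fact vfieldZ_linear (h : smooth_fun M) (X : vfield) (a : R) f g :
  h * X (smooth_cst M a * f + g) = smooth_cst M a * (h * X f) + h * X g.
Proof. by rewrite vf_linear mulrDr mulrCA. Qed.
Fact vfieldZ_leibniz (h : smooth_fun M) (X : vfield) f g :
  h * X (f * g) = h * X f * g + f * (h * X g).
Proof. by rewrite vf_leibniz mulrDr mulrA [h * (f * _)]mulrCA. Qed.
Definition vfieldZ (h : smooth_fun M) (X : vfield) : vfield :=
  VField (vfieldZ_linear h X) (vfieldZ_leibniz h X).

Fact vfieldDA : associative vfieldD.
Proof. by move=> X Y Z; apply: vfield_ext => f /=; rewrite addrA. Qed.
Fact vfieldDC : commutative vfieldD.
Proof. by move=> X Y; apply: vfield_ext => f /=; rewrite addrC. Qed.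
Fact vfield0D : left_id vfield0 vfieldD.
Proof. by move=> X; apply: vfield_ext => f /=; rewrite add0r. Qed.
Fact vfieldND : left_inverse vfield0 vfieldN vfieldD.
Proof. by move=> X; apply: vfield_ext => f /=; rewrite addNr. Qed.

HB.instance Definition _ :=
  GRing.isZmodule.Build vfield vfieldDA vfieldDC vfield0D vfieldND.

Fact vfieldZA (f g : smooth_fun M) (X : vfield) :
  vfieldZ f (vfieldZ g X) = vfieldZ (f * g) X.
Proof. by apply: vfield_ext => h /=; rewrite mulrA. Qed.
Fact vfieldZ1 : left_id 1 vfieldZ.
Proof. by move=> X; apply: vfield_ext => h /=; rewrite mul1r. Qed.
Fact vfieldZDr : right_distributive vfieldZ +%R.
Proof. by move=> f X Y; apply: vfield_ext => h /=; rewrite mulrDr. Qed.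
Fact vfieldZDl (X : vfield) :
  {morph (fun f : smooth_fun M => vfieldZ f X) : f g / f + g}.
Proof. by move=> f g; apply: vfield_ext => h /=; rewrite mulrDl. Qed.

HB.instance Definition _ := GRing.Zmodule_isLmodule.Build (smooth_fun M) vfield
  vfieldZA vfieldZ1 vfieldZDr vfieldZDl.

Fact vbracket_linear (X Y : vfield) (a : R) f g :
  X (Y (smooth_cst M a * f + g)) - Y (X (smooth_cst M a * f + g)) =
  smooth_cst M a * (X (Y f) - Y (X f)) + (X (Y g) - Y (X g)).
Proof. by rewrite !vf_linear mulrBr opprD addrACA. Qed.
Fact vbracket_leibniz (X Y : vfield) f g :
  X (Y (f * g)) - Y (X (f * g)) =
  (X (Y f) - Y (X f)) * g + f * (X (Y g) - Y (X g)).
Proof.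
rewrite !vf_leibniz !vfD !vf_leibniz mulrBl mulrBr.
exact: comm_cancel.
Qed.
Definition vbracket (X Y : vfield) : vfield :=
  VField (vbracket_linear X Y) (vbracket_leibniz X Y).

End VectorFields.

Section GaugeAlgebroid.
Context {R : realType} {n : nat} {M : manifold R n}.

Definition Rlinear (V W : lmodType (smooth_fun M)) (F : V -> W) :=
  forall (a : R) x y,
    F (smooth_cst M a *: x + y) = smooth_cst M a *: F x + F y.

Variable E : vbundle M.

(* Sections of the gauge Lie algebroid of E.  The vector field [gsym d] = j(d) is
   part of the data; it is determined by the operator as soon as E has positive
   rank (and if E = 0, this gives the tangent bundle, as the Atiyah sequence
   requires). *)
Record gauge_sec := Gauge {
  gop :> section E -> section E;
  gsym : vfield M;
  gop_Rlinear : Rlinear gop;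
  gop_leibniz : forall (f : smooth_fun M) u, gop (f *: u) = f *: gop u + gsym f *: u }.

Lemma gauge_ext (d e : gauge_sec) : (forall u, d u = e u) -> gsym d = gsym e -> d = e.
Proof.
case: d e => [d X d1 d2] [e Y e1 e2] /= de XY; subst Y.
have {}de : d = e by exact/funext.
by subst e; congr Gauge; exact: Prop_irrelevance.
Qed.

Lemma gopD (d : gauge_sec) u v : d (u + v) = d u + d v.
Proof.
have := gop_Rlinear d 1 u v.
have -> : smooth_cst M 1 = 1 by exact: val_inj.
by rewrite !scale1r.
Qed.

Lemma gop0 (d : gauge_sec) : d 0 = 0.
Proof. by apply: (addrI (d 0)); rewrite -gopD !addr0. Qed.

Lemma gopN (d : gauge_sec) u : d (- u) = - d u.
Proof. by apply: (addrI (d u)); rewrite -gopD !subrr gop0. Qed.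

HB.instance Definition _ := gen_eqMixin gauge_sec.
HB.instance Definition _ := gen_choiceMixin gauge_sec.

Fact gauge0_Rlinear : Rlinear (fun _ : section E => 0 : section E).
Proof. by move=> a x y; rewrite scaler0 addr0. Qed.
Fact gauge0_leibniz (f : smooth_fun M) (u : section E) :
  0 = f *: 0 + (0 : vfield M) f *: u.
Proof. by rewrite scaler0 scale0r addr0. Qed.
Definition gauge0 : gauge_sec := Gauge gauge0_Rlinear gauge0_leibniz.

Fact gaugeD_Rlinear (d e : gauge_sec) : Rlinear (fun u : section E => d u + e u).
Proof. by move=> a x y; rewrite !gop_Rlinear scalerDr addrACA. Qed.
Fact gaugeD_leibniz (d e : gauge_sec) (f : smooth_fun M) u :
  d (f *: u) + e (f *: u) = f *: (d u + e u) + (gsym d + gsym e) f *: u.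
Proof. by rewrite !gop_leibniz scalerDr scalerDl addrACA. Qed.
Definition gaugeD (d e : gauge_sec) : gauge_sec :=
  Gauge (gaugeD_Rlinear d e) (gaugeD_leibniz d e).

Fact gaugeN_Rlinear (d : gauge_sec) : Rlinear (fun u : section E => - d u).
Proof. by move=> a x y; rewrite gop_Rlinear opprD scalerN. Qed.
Fact gaugeN_leibniz (d : gauge_sec) (f : smooth_fun M) u :
  - d (f *: u) = f *: - d u + (- gsym d) f *: u.
Proof. by rewrite gop_leibniz opprD scalerN scaleNr. Qed.
Definition gaugeN (d : gauge_sec) : gauge_sec := Gauge (gaugeN_Rlinear d) (gaugeN_leibniz d).

Fact gaugeZ_Rlinear (h : smooth_fun M) (d : gauge_sec) : Rlinear (fun u : section E => h *: d u).
Proof. by move=> a x y; rewrite gop_Rlinear scalerDr !scalerA mulrC. Qed.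
Fact gaugeZ_leibniz (h : smooth_fun M) (d : gauge_sec) (f : smooth_fun M) u :
  h *: d (f *: u) = f *: (h *: d u) + (h *: gsym d) f *: u.
Proof. by rewrite gop_leibniz scalerDr !scalerA [h * f]mulrC. Qed.
Definition gaugeZ (h : smooth_fun M) (d : gauge_sec) : gauge_sec :=
  Gauge (gaugeZ_Rlinear h d) (gaugeZ_leibniz h d).

Fact gaugeDA : associative gaugeD.
Proof. by move=> d e f; apply: gauge_ext => [u|] /=; rewrite addrA. Qed.
Fact gaugeDC : commutative gaugeD.
Proof. by move=> d e; apply: gauge_ext => [u|] /=; rewrite addrC. Qed.
Fact gauge0D : left_id gauge0 gaugeD.
Proof. by move=> d; apply: gauge_ext => [u|] /=; rewrite add0r. Qed.
Fact gaugeND : left_inverse gauge0 gaugeN gaugeD.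
Proof. by move=> d; apply: gauge_ext => [u|] /=; rewrite addNr. Qed.

HB.instance Definition _ :=
  GRing.isZmodule.Build gauge_sec gaugeDA gaugeDC gauge0D gaugeND.

Fact gaugeZA (f g : smooth_fun M) (d : gauge_sec) :
  gaugeZ f (gaugeZ g d) = gaugeZ (f * g) d.
Proof. by apply: gauge_ext => [u|] /=; rewrite scalerA. Qed.
Fact gaugeZ1 : left_id 1 gaugeZ.
Proof. by move=> d; apply: gauge_ext => [u|] /=; rewrite scale1r. Qed.
Fact gaugeZDr : right_distributive gaugeZ +%R.
Proof. by move=> f d e; apply: gauge_ext => [u|] /=; rewrite scalerDr. Qed.
Fact gaugeZDl (d : gauge_sec) :
  {morph (fun f : smooth_fun M => gaugeZ f d) : f g / f + g}.
Proof. by move=> f g; apply: gauge_ext => [u|] /=; rewrite scalerDl. Qed.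

HB.instance Definition _ := GRing.Zmodule_isLmodule.Build (smooth_fun M) gauge_sec
  gaugeZA gaugeZ1 gaugeZDr gaugeZDl.

Fact gsym_is_linear : linear gsym.
Proof. by []. Qed.
HB.instance Definition _ :=
  GRing.isLinear.Build (smooth_fun M) gauge_sec (vfield M) _ gsym gsym_is_linear.

Fact gauge_id_leibniz (f : smooth_fun M) (u : section E) :
  f *: u = f *: u + (0 : vfield M) f *: u.
Proof. by rewrite scale0r addr0. Qed.
Definition gauge_id : gauge_sec := @Gauge id 0 (fun a x y => erefl) gauge_id_leibniz.

Fact gbracket_Rlinear (d e : gauge_sec) : Rlinear (fun u : section E => d (e u) - e (d u)).
Proof. by move=> a x y; rewrite !gop_Rlinear scalerBr opprD addrACA. Qed.
Fact gbracket_leibniz (d e : gauge_sec) (f : smooth_fun M) u :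
  d (e (f *: u)) - e (d (f *: u)) =
  f *: (d (e u) - e (d u)) + vbracket (gsym d) (gsym e) f *: u.
Proof.
rewrite !gop_leibniz !gopD !gop_leibniz scalerBr /= scalerBl.
exact: comm_cancel.
Qed.
Definition gbracket (d e : gauge_sec) : gauge_sec :=
  Gauge (gbracket_Rlinear d e) (gbracket_leibniz d e).

(* Bundle maps over the identity are represented by maps between section modules
   that are linear over the smooth functions.  Thus sections of the first jet
   bundle are the elements nu of Hom(DE, E) with nu(Psi) = Psi(nu(Id)) for every
   Psi in gl(E), gl(E) being the kernel of the symbol map. *)
Definition is_jet (nu : {linear gauge_sec -> section E}) :=
  forall Psi : gauge_sec, gsym Psi = 0 -> nu Psi = Psi (nu gauge_id).

Definition jet_d (u : section E) (d : gauge_sec) : section E := d u.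
Fact jet_d_is_linear (u : section E) : linear (jet_d u).
Proof. by []. Qed.
HB.instance Definition _ (u : section E) := GRing.isLinear.Build (smooth_fun M)
  gauge_sec (section E) _ (jet_d u) (jet_d_is_linear u).

Lemma is_jet_d (u : section E) : is_jet (jet_d u).
Proof. by []. Qed.

End GaugeAlgebroid.

Section Pairings.
Context {R : realType} {n : nat} {M : manifold R n}.

(* Smooth bundle maps A (x) B -> E. *)
Record pairing (A B E : vbundle M) := Pairing {
  pair_val :> forall m, A m -> B m -> E m;
  pair_linearl : forall m (b : B m), linear (fun a => pair_val a b);
  pair_linearr : forall m (a : A m), linear (pair_val a);
  pair_smooth : forall U s t, open U -> smooth_sec U s -> smooth_sec U t ->
    smooth_sec U (fun m => pair_val (s m) (t m)) }.

Definition psec (A B E : vbundle M) (P : pairing A B E)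
    (X : section A) (Y : section B) : section E :=
  MkSection (pair_smooth P openT (section_smooth X) (section_smooth Y)).

Definition pflip (A B E : vbundle M) (P : pairing A B E) : pairing B A E :=
  @Pairing B A E (fun m b a => P m a b) (@pair_linearr _ _ _ P)
    (@pair_linearl _ _ _ P)
    (fun U s t oU ss st => pair_smooth P oU st ss).

Definition nondegenerate (A B E : vbundle M) (P : pairing A B E) :=
  (forall m (a : A m), (forall b, P m a b = 0) -> a = 0) /\
  (forall m (b : B m), (forall a, P m a b = 0) -> b = 0).

End Pairings.

Section Subbundles.
Context {R : realType} {n : nat} {M : manifold R n} {K : vbundle M}.

Definition local_frame (L : forall m, {vspace K m}) r (U : set M)
    (e : forall m, r.-tuple (K m)) :=
  [/\ open U, forall a, smooth_sec U (fun m => tnth (e m) a) &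
      forall m, U m -> basis_of (L m) (e m)].

Record subbundle := Subbundle {
  srank : nat;
  sfib :> forall m, {vspace K m};
  sframe_cover : forall m, exists U (e : forall m, srank.-tuple (K m)),
    local_frame sfib U e /\ U m }.

Variable L : subbundle.

Definition sindex : Type :=
  {p : set M * (forall m, (srank L).-tuple (K m)) | local_frame L p.1 p.2}.

Definition sframe (p : sindex) m : (srank L).-tuple (subvs_of (L m)) :=
  [tuple of map (vsproj (L m)) ((sval p).2 m)].

Lemma sframe_val (p : sindex) m b : (sval p).1 m ->
  vsval (tnth (sframe p m) b) = tnth ((sval p).2 m) b.
Proof.
move=> pm; rewrite tnth_map vsprojK //.
have [_ _ /(_ m pm) be] := svalP p.
by apply: (basis_mem be); exact: mem_tnth.
Qed.

Lemma sframe_basis (p : sindex) m : (sval p).1 m ->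
  basis_of fullv (sframe p m).
Proof.
move=> pm; have [_ _ /(_ m pm) be] := svalP p.
rewrite basisEfree.
have fr : free (sframe p m).
  apply/freeP => k; move/(congr1 vsval); rewrite linear0 linear_sum /= => k0.
  have /freeP fe := basis_free be; apply: fe; rewrite -[RHS]k0; apply: eq_bigr => i _.
  by congr (_ *: _); have := sframe_val i pm; rewrite !(tnth_nth 0) => ->.
by rewrite fr subvf size_tuple dimvf /= /dim /= -(size_basis be).
Qed.

(* The Gram matrix of a local frame is used to solve smoothly for coordinates in
   a frame of a subbundle. *)
Lemma gram_unit k l (A : 'M[R]_(k, l)) :
  (forall c : 'cV_l, A *m c = 0 -> c = 0) -> A^T *m A \in unitmx.
Proof.
move=> injA; rewrite -row_free_unit -kermx_eq0; apply/eqP/row_matrixP => i.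
set v := row i _.
have vA : v *m (A^T *m A) = 0 by apply/sub_kermxP; exact: row_sub.
have : (A *m v^T)^T *m (A *m v^T) = 0.
  by rewrite trmx_mul trmxK -mulmxA [A^T *m _]mulmxA [v *m _]mulmxA vA mul0mx.
move/(congr1 (fun X : 'M_1 => X 0 0)); rewrite [LHS]mxE [RHS]mxE => sq.
have nng (j : 'I_k) : true -> 0 <= (A *m v^T)^T 0 j * (A *m v^T) j 0.
  by move=> _; rewrite [X in X * _]mxE -expr2 sqr_ge0.
have Av : A *m v^T = 0.
  apply/matrixP => a b; rewrite (ord1 b) [RHS]mxE.
  have := psumr_eq0P nng sq (erefl : true); move=> /(_ a).
  by rewrite [X in X * _]mxE -expr2 => /eqP; rewrite sqrf_eq0 => /eqP.
by rewrite -[v]trmxK (injA _ Av) trmx0 row0.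
Qed.

Lemma sub_coord_smooth (p : sindex) V (s : forall m, subvs_of (L m)) :
  open V -> smooth_sec V (fun m => vsval (s m) : K m) ->
  forall a, smooth_on ((sval p).1 `&` V) (fun m => coord (sframe p m) a (s m)).
Proof.
move=> oV ss a; have [oU se be] := svalP p.
apply: smooth_on_local => x [Ux Vx]; have [j jx] := vdom_cover K x.
set W := vdom j `&` ((sval p).1 `&` V); exists W; first by [].
have oW : open W by apply: openI; [exact: vdom_open|exact: openI].
pose A m := \matrix_(b < vrank K, c < srank L)
  coord (vframe j m) b (tnth ((sval p).2 m) c).
pose S m := \col_(b < vrank K) coord (vframe j m) b (vsval (s m)).
have sA b c : smooth_on W (fun m => A m b c).
  apply: smooth_on_ext (smooth_on_sub _ (se c j b)) => // [m _|m [? [? ?]]//].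
  by rewrite mxE.
have sAt b c : smooth_on W (fun m => (A m)^T b c).
  by apply: smooth_on_ext (sA c b) => // m _; rewrite [RHS]mxE.
have sS b c : smooth_on W (fun m => S m b c).
  apply: smooth_on_ext (smooth_on_sub _ (ss j b)) => // [m _|m [? [? ?]]//].
  by rewrite mxE.
have AU m : W m -> (A m)^T *m A m \in unitmx.
  move=> [jm [Um _]]; apply: gram_unit => c Ac.
  have /freeP fe := basis_free (be m Um).
  have H : \sum_(i < srank L) c i 0 *: ((sval p).2 m)`_i = 0.
    rewrite (frame_sum (\sum_(i < srank L) _) jm); apply: big1 => b _.
    rewrite linear_sum /=.
    have := congr1 (fun X : 'cV_ _ => X b 0) Ac; rewrite !mxE => Ab.
    rewrite (_ : \sum_i _ = 0) ?scale0r // -[RHS]Ab; apply: eq_bigr => i _.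
    by rewrite linearZ /= mxE mulrC -tnth_nth.
  by apply/colP => i; rewrite (fe (fun i => c i 0) H) mxE.
have : smooth_on W (fun m => (invmx ((A m)^T *m A m) *m ((A m)^T *m S m)) a 0).
  apply: smooth_on_mulmx => //.
    by apply: smooth_on_invmx => // b c; exact: smooth_on_mulmx.
  by move=> b c; exact: smooth_on_mulmx.
apply: smooth_on_ext => // m Wm; have [jm [Um Vm]] := Wm.
have -> : S m = A m *m \col_c coord (sframe p m) c (s m).
  apply/colP => b; rewrite !mxE.
  rewrite {1}(coord_basis (sframe_basis Um) (memvf (s m))) !linear_sum /=.
  apply: eq_bigr => c _; rewrite !mxE !linearZ /= -tnth_nth sframe_val //.
  by rewrite mulrC.
by rewrite [(A m)^T *m (_ *m _)]mulmxA mulKmx ?AU // mxE.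
Qed.

Lemma sub_frame_smooth (p : sindex) V (s : forall m, subvs_of (L m)) :
  open V -> V `<=` (sval p).1 ->
  (forall a, smooth_on V (fun m => coord (sframe p m) a (s m))) ->
  smooth_sec V (fun m => vsval (s m) : K m).
Proof.
move=> oV Vp sc j b; have [oU se be] := svalP p.
have oW : open (vdom j `&` V) by apply: openI => //; exact: vdom_open.
have : smooth_on (vdom j `&` V) (fun m => \sum_c coord (sframe p m) c (s m) *
    coord (vframe j m) b (tnth ((sval p).2 m) c)).
  apply: smooth_on_sum => // c; apply: smooth_onM => //.
    by apply: smooth_on_sub (sc c) => m [].
  by apply: smooth_on_sub (se c j b) => m [? /Vp].
apply: smooth_on_ext => // m [jm /Vp Um].
rewrite {2}(coord_basis (sframe_basis Um) (memvf (s m))) !linear_sum /=.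
by apply: eq_bigr => c _; rewrite !linearZ /= -tnth_nth sframe_val.
Qed.

Fact sdom_open (p : sindex) : open (sval p).1.
Proof. by case: (svalP p). Qed.

Fact sdom_cover m : exists p : sindex, (sval p).1 m.
Proof.
have [U [e [Ue Um]]] := sframe_cover L m.
by exists (exist (fun p => local_frame L p.1 p.2) (U, e) Ue).
Qed.

Fact stransition (p q : sindex) (a b : 'I_(srank L)) :
  smooth_on ((sval p).1 `&` (sval q).1)
    (fun m => coord (sframe p m) a (tnth (sframe q m) b)).
Proof.
have [oU se be] := svalP q.
apply: sub_coord_smooth => // j c.
have oW : open (vdom j `&` (sval q).1) by apply: openI => //; exact: vdom_open.
by apply: smooth_on_ext (se b j c) => // m [jm qm]; rewrite sframe_val.
Qed.

(* A subbundle as a vector bundle: the frames are all its smooth local frames. *)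
Definition sub_vbundle : vbundle M :=
  @VBundle R n M (srank L) (fun m => subvs_of (L m)) sindex
    (fun p => (sval p).1) sframe sdom_open sdom_cover sframe_basis stransition.

Lemma smooth_sec_vsval U (s : forall m, sub_vbundle m) : open U ->
  smooth_sec U s -> smooth_sec U (fun m => vsval (s m) : K m).
Proof.
move=> oU ss; apply: smooth_sec_local => // m Um.
have [p pm] := sdom_cover m; have [j jm] := vdom_cover K m.
exists ((sval p).1 `&` U), j; split=> //.
- by apply: openI => //; exact: sdom_open.
- move=> a; have oW : open ((sval p).1 `&` U) by apply: openI => //; exact: sdom_open.
  have /(_ j a) : smooth_sec ((sval p).1 `&` U) (fun m => vsval (s m) : K m).
    by apply: (sub_frame_smooth (p := p)) => // b; exact: ss.
  by apply: smooth_on_sub => x [].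
Qed.

Definition sub_inclusion (s : section sub_vbundle) : section K :=
  MkSection (smooth_sec_vsval openT (section_smooth s)).

Fact sub_inclusion_is_linear : linear sub_inclusion.
Proof. by move=> f s t; apply: section_ext. Qed.
HB.instance Definition _ := GRing.isLinear.Build (smooth_fun M)
  (section sub_vbundle) (section K) _ sub_inclusion sub_inclusion_is_linear.

Lemma smooth_sec_Subvs (s : section K) (sL : forall m, s m \in L m) :
  smooth_sec (E := sub_vbundle) setT (fun m => Subvs (sL m)).
Proof.
move=> p a; apply: sub_coord_smooth; first exact: openT.
exact: section_smooth.
Qed.

Definition sub_section (s : section K) (sL : forall m, s m \in L m) :
  section sub_vbundle := MkSection (smooth_sec_Subvs sL).

End Subbundles.

Section Algebroids.
Context {R : realType} {n : nat} {M : manifold R n}.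
Implicit Types A B E K : vbundle M.

(* Leibniz algebras over R (not over the smooth functions). *)
Record is_leibniz_algebra K (br : section K -> section K -> section K) : Prop := {
  leibniz_Rlinearl : forall Y, Rlinear (fun X => br X Y);
  leibniz_Rlinearr : forall X, Rlinear (br X);
  leibniz_identity : forall X Y Z,
    br X (br Y Z) = br (br X Y) Z + br Y (br X Z) }.

(* The data, without axioms, of a bracket and an anchor on A and of an action
   A -> DE on E. *)
Record algebroid_action A E := AlgebroidAction {
  alg_bracket : section A -> section A -> section A;
  alg_anchor : {linear section A -> vfield M};
  alg_rep : {linear section A -> gauge_sec E} }.

Record is_lie_algebroid A E (a : algebroid_action A E) : Prop := {
  lie_leibniz_algebra : is_leibniz_algebra (alg_bracket a);
  lie_alternating : forall X, alg_bracket a X X = 0;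
  lie_leibniz_rule : forall X (f : smooth_fun M) Y,
    alg_bracket a X (f *: Y) = f *: alg_bracket a X Y + alg_anchor a X f *: Y;
  lie_anchor_bracket : forall X Y,
    alg_anchor a (alg_bracket a X Y) = vbracket (alg_anchor a X) (alg_anchor a Y) }.

Record is_representation A E (a : algebroid_action A E) : Prop := {
  rep_anchor : forall X, gsym (alg_rep a X) = alg_anchor a X;
  rep_bracket : forall X Y,
    alg_rep a (alg_bracket a X Y) = gbracket (alg_rep a X) (alg_rep a Y) }.

Definition cochain A E k := ('I_k -> section A) -> section E.

(* Sections of Hom(/\^k A, E): alternating maps multilinear over the smooth
   functions. *)
Definition is_form A E k (mu : cochain A E k) :=
  (forall X (i : 'I_k), linear (fun Y => mu [eta X with i |-> Y])) /\
  (forall X (i j : 'I_k), i != j -> X i = X j -> mu X = 0).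

(* Sections of Hom(/\^k A, E)_B, where B is embedded in Hom(A, E) by P: filling
   all slots but the last one gives a section of B.  No condition if k = 0. *)
Definition is_form_in A B E (P : pairing A B E) k (mu : cochain A E k) :=
  is_form mu /\
  forall i : 'I_k, i.+1 = k :> nat ->
  forall X, exists xi : section B, forall Y, mu [eta X with i |-> Y] = psec P Y xi.

(* Chevalley-Eilenberg coboundary.  In the second sum [X_i, X_j] is put in the
   slot of X_j rather than in front, which turns the usual sign (-1)^(i+j) into
   (-1)^(i+1). *)
Definition CE_d A E (a : algebroid_action A E) k (mu : cochain A E k) :
    cochain A E k.+1 := fun X =>
  \sum_(i < k.+1) (-1) ^+ i *:
    (alg_rep a (X i) (mu (fun l => X (lift i l)))
     - \sum_(j < k.+1 | (i < j)%N)
         mu (fun l => if lift i l == j then alg_bracket a (X i) (X j)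
                      else X (lift i l))).

Definition invariant_action A B E (P : pairing A B E) (a : algebroid_action A E) :=
  forall k (mu : cochain A E k), is_form_in P mu -> is_form_in P (CE_d a mu).

Record is_E_dual_pair A B E (P : pairing A B E)
    (a : algebroid_action A E) (b : algebroid_action B E) : Prop := {
  dual_nondegenerate : nondegenerate P;
  dual_lieA : is_lie_algebroid a;
  dual_lieB : is_lie_algebroid b;
  dual_repA : is_representation a;
  dual_repB : is_representation b;
  dual_invA : invariant_action P a;
  dual_invB : invariant_action (pflip P) b }.

(* A section of B seen as a section of Hom(A, E). *)
Definition cochain1 A B E (P : pairing A B E) (xi : section B) : cochain A E 1 :=
  fun X => psec P (X ord0) xi.

(* [d_sec] and [lie_dual] pick the section of B determined by its pairings with
   the sections of A: unique since P is nondegenerate, and existing in an E-dual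
   pair since the action is B-invariant. *)
Definition d_sec A B E (P : pairing A B E) (a : algebroid_action A E)
    (u : section E) : section B :=
  xget 0 [set xi | cochain1 P xi = CE_d a (fun _ : 'I_0 -> section A => u)].

Definition lie_dual A B E (P : pairing A B E) (a : algebroid_action A E)
    (X : section A) (xi : section B) : section B :=
  xget 0 [set eta | forall Y, psec P Y eta =
    alg_rep a X (psec P Y xi) - psec P (alg_bracket a X Y) xi].

(* Lie derivative along X of a section Xi of Hom(/\^k B, E). *)
Definition lie_cochain A B E (P : pairing A B E) (a : algebroid_action A E)
    (X : section A) k (Xi : cochain B E k) : cochain B E k := fun xi =>
  alg_rep a X (Xi xi) -
  \sum_(i < k) Xi [eta xi with i |-> lie_dual P a X (xi i)].

Record is_E_lie_bialgebroid A B E (P : pairing A B E)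
    (a : algebroid_action A E) (b : algebroid_action B E) : Prop := {
  bialgebroid_dual_pair : is_E_dual_pair P a b;
  bialgebroid_cocycle : forall (X Y : section A) (xi : 'I_2 -> section B),
    CE_d b (cochain1 (pflip P) (alg_bracket a X Y)) xi =
    lie_cochain P a X (CE_d b (cochain1 (pflip P) Y)) xi -
    lie_cochain P a Y (CE_d b (cochain1 (pflip P) X)) xi;
  bialgebroid_lie_d : forall (u : section E) (X : section A),
    lie_dual (pflip P) b (d_sec P a u) X = - alg_bracket a (d_sec (pflip P) b u) X;
  bialgebroid_d_d : forall u : section E,
    psec P (d_sec (pflip P) b u) (d_sec P a u) = 0 }.

(* X is the section of K identified with rho^*(nu), i.e. (X, Y)_E = 1/2 nu(rho(Y)). *)
Definition is_rho_star K E (P : pairing K K E) (rho : {linear section K -> gauge_sec E})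
    (nu : {linear gauge_sec E -> section E}) (X : section K) :=
  forall Y, psec P X Y = smooth_cst M (2^-1) *: nu (rho Y).

Record is_E_courant K E (P : pairing K K E)
    (br : section K -> section K -> section K)
    (rho : {linear section K -> gauge_sec E}) : Prop := {
  courant_leibniz : is_leibniz_algebra br;
  courant_symmetric : forall m (x y : K m), P m x y = P m y x;
  courant_nondegenerate : nondegenerate P;
  courant_EC1 : forall X Y, rho (br X Y) = gbracket (rho X) (rho Y);
  courant_EC2 : forall X, is_rho_star P rho (jet_d (psec P X X)) (br X X);
  courant_EC3 : forall X Y Z,
    rho X (psec P Y Z) = psec P (br X Y) Z + psec P Y (br X Z);
  courant_EC4 : forall nu, is_jet nu -> exists X, is_rho_star P rho nu X;
  courant_EC5 : forall nu X, is_jet nu -> is_rho_star P rho nu X -> rho X = 0 }.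

Record is_dirac K E (P : pairing K K E)
    (br : section K -> section K -> section K) (L : subbundle (K := K)) : Prop := {
  dirac_closed : forall X Y : section K, (forall m, X m \in L m) ->
    (forall m, Y m \in L m) -> forall m, br X Y m \in L m;
  dirac_perp : forall m (e : K m),
    e \in L m <-> (forall l, l \in L m -> P m e l = 0) }.

End Algebroids.

Section DiracAlgebroid.
Context {R : realType} {n : nat} {M : manifold R n} {K E : vbundle M}.
Variables (P : pairing K K E) (br : section K -> section K -> section K).
Variable rho : {linear section K -> gauge_sec E}.

Fact dirac_bracket_in (L : subbundle (K := K)) (hL : is_dirac P br L)
    (X Y : section (sub_vbundle L)) m :
  br (sub_inclusion X) (sub_inclusion Y) m \in L m.
Proof. by apply: (dirac_closed hL) => x; exact: subvsP. Qed.

Definition dirac_algebroid (L : subbundle (K := K)) (hL : is_dirac P br L) :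
    algebroid_action (sub_vbundle L) E :=
  {| alg_bracket := fun X Y => sub_section (dirac_bracket_in hL X Y);
     alg_anchor := @gsym _ _ _ E \o (rho \o @sub_inclusion _ _ _ _ L);
     alg_rep := rho \o @sub_inclusion _ _ _ _ L |}.

Section Pairing.
Variables A B : subbundle (K := K).

Fact dual_pairing_linearl m (b : sub_vbundle B m) :
  linear (fun a : sub_vbundle A m => 2 *: P m (vsval a) (vsval b)).
Proof.
by move=> k x y; rewrite linearP /= pair_linearl scalerDr !scalerA mulrC.
Qed.

Fact dual_pairing_linearr m (a : sub_vbundle A m) :
  linear (fun b : sub_vbundle B m => 2 *: P m (vsval a) (vsval b)).
Proof.
by move=> k x y; rewrite linearP /= pair_linearr scalerDr !scalerA mulrC.
Qed.

Fact dual_pairing_smooth U (s : forall m, sub_vbundle A m)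
    (t : forall m, sub_vbundle B m) : open U -> smooth_sec U s -> smooth_sec U t ->
  smooth_sec U (fun m => 2 *: P m (vsval (s m)) (vsval (t m))).
Proof.
move=> oU ss st; apply: smooth_secZ => //; first exact: smooth_on_cst.
by apply: pair_smooth => //; exact: smooth_sec_vsval.
Qed.

Definition dual_pairing : pairing (sub_vbundle A) (sub_vbundle B) E :=
  Pairing dual_pairing_linearl dual_pairing_linearr dual_pairing_smooth.

End Pairing.
End DiracAlgebroid.

(* Main.v *)
Require Import Defs.
From mathcomp Require Import all_boot all_order all_algebra.
From mathcomp Require Import all_classical all_reals.
From mathcomp Require Import topology normedtype landau derive.
From mathcomp Require Import interval_inference sequences realfun exp ring.
Import Defs.
Set Implicit Arguments.
Unset Strict Implicit.
Unset Printing Implicit Defensive.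
Import Order.TTheory GRing.Theory Num.Theory.
Import numFieldNormedType.Exports.
Local Open Scope classical_set_scope.
Local Open Scope ring_scope.

(** Write [D u] for the section of [K] that represents [rho^* (d u)], that is
    [(D u, Z) = 1/2 rho(Z) u].  Everything follows from projecting identities of
    [K] onto the two summands, using that [A] and [B] are isotropic: for [X] in
    [A] and [xi] in [B],
      - [d^A u] and [d^B u] are the components of [D u] in [B] and [A]
        ([d_secE]), because pairing with a section of [A] only sees the [B]-part;
      - [L_X xi] is the component of [[X, xi]] in [B] ([lie_dualE]), by (EC-3).
    In particular [d u] and [L_X xi] are represented by sections of [B], and the
    Cartan formula [i_X d = L_X - d i_X] propagates this to all degrees: it gives
    the invariance of the representations ([invariant_of_paired]), as well as the
    fact that [d] of a form is a form ([CE_d_form]).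

    Of the three compatibility conditions, [<d^B u, d^A u> = (D u, D u)] is half
    of [rho(D u) u = 0] by (EC-5).  The second one says that the [A]-component of
    [[D u, X]] is zero, and in fact [D u] is left central ([D_central]):
    [[X, D u] = D(rho(X) u)] accounts for the whole of the symmetrized bracket
    [[X, D u] + [D u, X] = 2 D(X, D u)].  For the cocycle condition, the formula
    for [[Y, xi] + [xi, Y]] turns [d^B Y] into [(xi, eta) |-> -2 ([Y, xi], eta)]
    ([CE_d_cochain1_bracket]).  The Lie derivative of that form along [X] is
    [-2 ([X, [Y, xi]], eta)] plus terms symmetric in [X] and [Y]
    ([lie_bracket_pairing]), so that the condition reduces to the Leibniz identity.

    These computations are made with global sections, hence need enough of them.
    A nondegenerate pairing separates global sections ([psec_injl]) since a vector
    of a bundle extends to a global section ([section_through]), which rests on the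
    existence of smooth bump functions ([bump_at]).  The components in [A] and [B]
    of a smooth section are smooth because local frames of [A] and [B] together
    form a local frame of [K] ([section_decomposition]). *)

(** * Flat functions and bump functions *)

Section Flat.
Context {R : realType}.
Implicit Types (p : {poly R}) (t : R).

(** The functions [p(1/t) e^(-1/t)] extended by [0] to [t <= 0]: the family is
    stable under differentiation, so its members are all smooth. *)
Definition flat p t : R := if 0 < t then p.[t^-1] * expR (- t^-1) else 0.

Lemma flat_le0 p t : t <= 0 -> flat p t = 0.
Proof. by move=> t0; rewrite /flat ltNge t0. Qed.

Lemma flat_gt0 t : 0 < t -> 0 < flat 1 t.
Proof. by move=> t0; rewrite /flat t0 hornerC mul1r expR_gt0. Qed.

Lemma flat_mulX p t : flat p t = t * flat (p * 'X) t.
Proof.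
rewrite /flat; case: ifPn => [t0|_]; last by rewrite mulr0.
by rewrite hornerMX mulrA [t * (_ * _)]mulrCA mulfV ?gt_eqF // mulr1.
Qed.

(** The exponential series gives [s^(i+1) <= (i+1)! e^s]; take [s = 1/t]. *)
Lemma flat_bound p : exists2 C, 0 <= C & forall t, `|flat p t| <= C * `|t|.
Proof.
exists (\sum_(i < size p) `|p`_i| * (i.+1)`!%:R).
  by apply: sumr_ge0 => i _; rewrite mulr_ge0.
move=> t; rewrite /flat; case: ifPn => [t0|_]; last first.
  by rewrite normr0 mulr_ge0 // sumr_ge0 // => i _; rewrite mulr_ge0.
rewrite (gtr0_norm t0); set s := t^-1.
have s0 : 0 < s by rewrite invr_gt0.
rewrite normrM (gtr0_norm (expR_gt0 _)) horner_coef expRN.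
rewrite ler_pdivrMr ?expR_gt0 // mulr_suml mulr_suml.
apply: le_trans (ler_norm_sum _ _ _) _; apply: ler_sum => i _.
rewrite normrM -!mulrA ler_wpM2l // (gtr0_norm (exprn_gt0 _ s0)).
have H : s ^+ i.+1 <= (i.+1)`!%:R * expR s.
  rewrite mulrC -ler_pdivrMr ?ltr0n ?fact_gt0 //.
  by apply: le_trans (expR_ge1Dxn i (ltW s0)); rewrite lerDr.
have -> : s ^+ i = t * s ^+ i.+1 by rewrite exprS mulrA mulfV ?mul1r // gt_eqF.
by rewrite [X in _ <= X]mulrCA ler_pM2l.
Qed.

Lemma flat_continuous0 p : {for 0, continuous (flat p)}.
Proof.
have [C C0 bC] := flat_bound p.
apply/cvgrPdist_le => e e0; rewrite flat_le0 //; near=> t.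
rewrite sub0r normrN (le_trans (bC t)) //.
have : `|t| <= e / (C + 1).
  by near: t; apply: (@nbhs0_le R R^o); rewrite divr_gt0 // ltr_wpDl.
rewrite ler_pdivlMr ?ltr_wpDl // => /(le_trans _); apply.
by rewrite mulrC ler_wpM2l // lerDl.
Unshelve. all: by end_near. Qed.

Definition dflat p : {poly R} := (p - p^`()) * 'X^2.

(** At [0] the difference quotient of [flat p] is [flat (p * 'X)], which is
    continuous and vanishes there. *)
Lemma is_derive_flat p t : is_derive t 1 (flat p) (flat (dflat p) t).
Proof.
case: (ltgtP t 0) => t0.
- have nt : \near t, (cst 0 : R -> R) t = flat p t.
    by near=> x; rewrite flat_le0 //; apply: ltW; near: x; exact: lt_nbhsl.
  by rewrite flat_le0 ?ltW //; apply: near_eq_is_derive nt _.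
- have nt : \near t, (horner p \o GRing.inv) t * (expR \o (-%R \o GRing.inv)) t = flat p t.
    by near=> x; rewrite /flat ifT //; near: x; exact: lt_nbhsr.
  apply: near_eq_is_derive nt _.
  have dV : is_derive t 1 (@GRing.inv R) (- t ^- 2).
    apply: is_derive_eq (@is_deriveV _ id t 1 1 _ _) _; first by rewrite gt_eqF.
    exact: mulr1.
  have dp := is_derive1_comp (is_derive_poly p t^-1) dV.
  have de := is_derive1_comp (is_derive_expR _) (is_deriveN dV).
  apply: is_derive_eq (is_deriveM dp de) _.
  rewrite /flat t0 /dflat hornerM hornerXn hornerD hornerN exprVn.
  rewrite -[_ *: _ + _]/(p.[t^-1] * (expR (- t^-1) * - (- t ^- 2)) +
    expR (- t^-1) * (p^`().[t^-1] * - t ^- 2)).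
  ring.
- subst t; rewrite flat_le0 //.
  have E : (fun h : R => h^-1 *: ((flat p \o shift 0) (h *: 1) - flat p 0)) = flat (p * 'X).
    apply/funext => h; rewrite /= addr0 [h *: 1]mulr1 (flat_le0 p (lexx 0)) subr0.
    have [->|h0] := eqVneq h 0; first by rewrite invr0 scale0r flat_le0.
    by rewrite flat_mulX /GRing.scale /= mulKf.
  have cv : flat (p * 'X) h @[h --> 0^'] --> (0 : R).
    rewrite -{2}(flat_le0 (p * 'X) (lexx 0)).
    exact: cvg_within_filter (flat_continuous0 (p := p * 'X)).
  split; first by rewrite /derivable E; apply/cvg_ex; exists 0.
  by rewrite /derive E; exact: cvg_lim.
Unshelve. all: by end_near. Qed.

End Flat.

Section Bump.
Context {R : realType}.

Lemma Ck_flat n k (U : set 'rV[R]_n) (g : 'rV[R]_n -> R) p : open U ->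
  Ck k U g -> Ck k U (fun x => flat p (g x)).
Proof.
move=> oU; have dfl q t : differentiable (flat q) (t : R).
  by apply/derivable1_diffP; have [] := is_derive_flat q t.
elim: k p => [|k IH] p.
  move=> cg x Ux; apply: continuous_comp; first exact: cg.
  exact: differentiable_continuous.
move=> /[dup] /CkS cg [dg Hg]; split=> [x Ux|i].
  by apply: (differentiable_comp (dg x Ux)).
apply: Ck_ext (CkM oU (IH (dflat p) cg) (Hg i)) => // x Ux.
have dfg : differentiable (flat p \o g) x by exact: differentiable_comp (dg x Ux) _.
apply/esym; apply: etrans (deriveE _ dfg) _.
rewrite (diff_comp (dg x Ux)) //= diff1E //= derive1E.
rewrite (derive_val (is_derive := is_derive_flat p (g x))) mulrC.
by congr (_ * _); apply/esym; apply: deriveE; exact: dg.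
Qed.

Lemma Cinfty_flat n (U : set 'rV[R]_n) (g : 'rV[R]_n -> R) p : open U ->
  Cinfty U g -> Cinfty U (fun x => flat p (g x)).
Proof. by move=> oU cg k; exact: Ck_flat. Qed.

Context {n : nat} (M : manifold R n).

Lemma smooth_on_mchart (i : mindex M) (c : 'I_n) :
  smooth_on (mdom i) (fun x => mchart i x 0 c).
Proof. by move=> j; rewrite setIC; apply: Cinfty_sub (mtransition j i c) => y; rewrite setIC. Qed.

Lemma smooth_on_flat (U : set M) (g : M -> R) p : open U ->
  smooth_on U g -> smooth_on U (fun x => flat p (g x)).
Proof.
move=> oU sg i; exact: (@Cinfty_flat _ _ (g \o mparam i)) (mchart_open oU) (sg i).
Qed.

(** In a chart, [flat 1] of [r^2 - |y - y0|^2] is positive at the centre and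
    vanishes outside a closed ball.  That ball is compact, hence closed in the manifold
    because the manifold is Hausdorff, and extension by [0] is smooth. *)
Lemma bump_at (x0 : M) (W : set M) : open W -> W x0 ->
  exists (f : smooth_fun M) (C : set M),
    [/\ closed C, C `<=` W, f x0 != 0 & forall x, ~ C x -> f x = 0].
Proof.
move=> oW Wx0; have [i ix0] := mdom_cover x0.
set y0 := mchart i x0; set O := mchart i @` (mdom i `&` W).
have oO : open O by exact: mchart_open.
have Oy0 : O y0 by exists x0.
have /nbhs_closedballP [r rO] : nbhs y0 O by exact: open_nbhs_nbhs.
pose r1 := r%:num; rewrite -/r1 in rO.
have r0 : 0 < r1 by rewrite /r1; exact: gt0.
pose C := mparam i @` closed_ball y0 r1.
have cC : closed C.
  apply: compact_closed; first exact: mhausdorff.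
  apply: continuous_compact.
    apply: continuous_in_subspaceT => y; rewrite inE => /rO [x [ix _] <-].
    by apply: mparam_continuous; exists x.
  apply: bounded_closed_compact; last exact: closed_ball_closed.
  exists (`|y0| + r1); split; first exact: num_real.
  move=> b lb y; rewrite closed_ballE // => yr; apply: le_trans (ltW lb).
  rewrite -[y](subKr y0) (le_trans (ler_normB _ _)) // lerD2l.
  exact: yr.
have CW : C `<=` mdom i `&` W.
  by move=> _ [y /rO [x iWx <-] <-]; rewrite mchartK //; case: iWx.
(* The Euclidean ball of radius r1 lies in the ball of the maximum norm. *)
pose q x : R := r1 ^+ 2 - \sum_(c < n) (mchart i x 0 c - y0 0 c) ^+ 2.
have qC x : mdom i x -> 0 < q x -> C x.
  move=> ix; rewrite subr_gt0 => qx; exists (mchart i x); last exact: mchartK.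
  rewrite closed_ballE // /closed_ball_ /= leNgt; apply/negP => ltr.
  have /mx_norm_neq0 [[a c] /= E] : mx_norm (y0 - mchart i x) != 0.
    by rewrite gt_eqF // (lt_trans r0).
  rewrite [Num.norm _]E in ltr.
  have : r1 ^+ 2 <= \sum_(c < n) (mchart i x 0 c - y0 0 c) ^+ 2.
    rewrite (bigD1 c) //= ler_wpDr ?sumr_ge0 // => [c' _|]; first exact: sqr_ge0.
    have {}ltr : r1 < `|mchart i x 0 c - y0 0 c|.
      by move: ltr; rewrite (ord1 a) !mxE distrC.
    rewrite -[leRHS]real_normK ?num_real // lerXn2r ?nnegrE ?(ltW ltr) ?(ltW r0) //.
  by rewrite leNgt qx.
have sq : smooth_on (mdom i) q.
  have oi := mdom_open i.
  apply: smooth_onD => //; first exact: smooth_on_cst.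
  apply: smooth_onN => //; apply: smooth_on_sum => // c.
  have sc : smooth_on (mdom i) (fun x => mchart i x 0 c - y0 0 c).
    exact: smooth_onD oi (smooth_on_mchart i c) (smooth_on_cst _ _).
  exact: smooth_onM.
pose f x := if x \in C then flat 1 (q x) else 0.
have fE x : mdom i x -> f x = flat 1 (q x).
  move=> ix; rewrite /f; case: ifPn => //; rewrite notin_setE => nC.
  by rewrite flat_le0 // leNgt; apply/negP => /(qC _ ix).
have sf : smooth_on setT f.
  apply: smooth_on_local => x _; have [Cx|nCx] := pselect (C x).
    exists (mdom i); first by case: (CW _ Cx).
    have oi := mdom_open i.
    apply: smooth_on_ext (smooth_on_flat 1 oi sq) => //.
    by move=> y /fE.
  exists (~` C) => //; apply: smooth_on_ext (smooth_on_cst _ 0); first exact: closed_openC.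
  by move=> y nCy; rewrite /f ifF //; apply/negbTE; rewrite notin_setE.
exists (mk_smooth_fun sf), C; split=> //.
- by move=> x /CW[].
- rewrite /= fE // gt_eqF // flat_gt0 // /q big1 ?subr0 ?exprn_gt0 // => c _.
  by rewrite subrr expr0n.
- by move=> x nCx /=; rewrite /f ifF //; apply/negbTE; rewrite notin_setE.
Qed.

End Bump.

(** * Global sections separate points *)

Section GlobalSections.
Context {R : realType} {n : nat} {M : manifold R n}.
Implicit Types A B E : vbundle M.

(** The combination of a local frame with the coordinates of [v], multiplied by a
    bump function supported in the domain of the frame. *)
Lemma section_through E m (v : E m) : exists s : section E, s m = v.
Proof.
have [j jm] := vdom_cover E m.
have [f [C [cC Cj fm fC]]] := bump_at (vdom_open j) jm.
pose s x : E x := \sum_b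
  ((f m)^-1 * coord (vframe j m) b v * f x) *: tnth (vframe j x) b.
have cs x b : vdom j x ->
    coord (vframe j x) b (s x) = (f m)^-1 * coord (vframe j m) b v * f x.
  move=> jx; rewrite /s.
  under eq_bigr do rewrite (tnth_nth 0).
  by rewrite coord_sum_free // (basis_free (vframe_basis jx)).
have ss : smooth_sec setT s.
  apply: smooth_sec_local => [|x _]; first exact: openT.
  have [Cx|nCx] := pselect (C x).
    exists (vdom j), j; split=> //; [exact: vdom_open|exact: Cj|exact: Cj|move=> a].
    rewrite setIid.
    have oj := vdom_open j.
    have sf : smooth_on (vdom j) f by apply: smooth_on_sub (smooth_funP f).
    apply: smooth_on_ext (smooth_onM oj (smooth_on_cst _ _) sf) => // y jy.
    by rewrite cs.
  have [k kx] := vdom_cover E x; exists (~` C), k.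
  split=> //; first exact: closed_openC.
  move=> a; apply: smooth_on_ext (smooth_on_cst _ 0).
    by apply: openI; [exact: closed_openC|exact: vdom_open].
  move=> y [/fC fy _]; rewrite /s big1 ?linear0 // => b _.
  by rewrite fy mulr0 scale0r.
exists (MkSection ss) => /=; rewrite [RHS](frame_sum v jm) /s; apply: eq_bigr => b _.
by rewrite mulrAC mulVf // mul1r.
Qed.

Lemma psec_linearl A B E (P : pairing A B E) (Y : section B) :
  linear (psec P ^~ Y).
Proof. by move=> f X X'; apply: section_ext => m; exact: pair_linearl. Qed.

Lemma psec_linearr A B E (P : pairing A B E) (X : section A) :
  linear (psec P X).
Proof. by move=> f Y Y'; apply: section_ext => m; exact: pair_linearr. Qed.

(** Pairings are known to be linear as plain functions, not as bundled linear
    maps; the next three lemmas serve such functions. *)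
Lemma linearfB (S : pzRingType) (U V : lmodType S) (f : U -> V) (x y : U) :
  linear f -> f (x - y) = f x - f y.
Proof. by move=> lf; have := lf (-1) y x; rewrite !scaleN1r ![- _ + _]addrC. Qed.

Lemma linearfD (S : pzRingType) (U V : lmodType S) (f : U -> V) (x y : U) :
  linear f -> f (x + y) = f x + f y.
Proof. by move=> lf; have := lf 1 x y; rewrite !scale1r. Qed.

Lemma linearf0 (S : pzRingType) (U V : lmodType S) (f : U -> V) :
  linear f -> f 0 = 0.
Proof. by move=> lf; have := linearfB 0 0 lf; rewrite !subrr. Qed.

Lemma psec_injl A B E (P : pairing A B E) (X X' : section A) :
  nondegenerate P -> (forall Y, psec P X Y = psec P X' Y) -> X = X'.
Proof.
move=> [nd _] XX'; apply: section_ext => m; apply/eqP; rewrite -subr_eq0.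
apply/eqP/nd => b; have [Y <-] := section_through b.
have /(congr1 (fun s : section E => s m)) /= XY := XX' Y.
by rewrite (linearfB _ _ (pair_linearl P (Y m))) /= XY subrr.
Qed.

Lemma nondegenerate_pflip A B E (P : pairing A B E) :
  nondegenerate P -> nondegenerate (pflip P).
Proof. by case. Qed.

Lemma psec_injr A B E (P : pairing A B E) (Y Y' : section B) :
  nondegenerate P -> (forall X, psec P X Y = psec P X Y') -> Y = Y'.
Proof.
move=> /nondegenerate_pflip nd YY'; apply: (psec_injl nd) => X.
by apply: section_ext => m; have := congr1 (fun s : section E => s m) (YY' X).
Qed.

End GlobalSections.

(** * Smoothness of the components of a section in a direct sum *)

Section Splitting.
Context {R : realType} {n : nat} {M : manifold R n} {K : vbundle M}.
Variables A B : subbundle (K := K).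
Hypothesis AB : forall m : M, (A m + B m)%VS = fullv /\ (A m :&: B m)%VS = 0%VS.

Lemma cat_local_frame m : exists U (e : forall x, (srank A).-tuple (K x))
    (f : forall x, (srank B).-tuple (K x)),
  [/\ U m, local_frame A U e, local_frame B U f &
      local_frame (fun x => fullv : {vspace K x}) U (fun x => [tuple of e x ++ f x])].
Proof.
have [U [e [[oU se be] Um]]] := sframe_cover A m.
have [V [f [[oV sf bf] Vm]]] := sframe_cover B m.
have oUV : open (U `&` V) by exact: openI.
have {}se a : smooth_sec (U `&` V) (fun x => tnth (e x) a).
  by apply: smooth_sec_sub (se a) => x [].
have {}sf a : smooth_sec (U `&` V) (fun x => tnth (f x) a).
  by apply: smooth_sec_sub (sf a) => x [].
exists (U `&` V), e, f; split=> //.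
- by split=> // x [/be].
- by split=> // x [_ /bf].
split=> // [a|x [/be bex /bf bfx]].
  case: (splitP a) => b ab.
    rewrite (_ : (fun x => _) = (fun x => tnth (e x) b)) //.
    apply: functional_extensionality_dep => x.
    by rewrite !(tnth_nth 0) /= nth_cat size_tuple ab ltn_ord.
  rewrite (_ : (fun x => _) = (fun x => tnth (f x) b)) //.
  apply: functional_extensionality_dep => x.
  by rewrite !(tnth_nth 0) /= nth_cat size_tuple ab ltnNge leq_addr /= addKn.
have [sAB iAB] := AB x.
rewrite -sAB; apply: cat_basis => //.
by apply/directv_addP.
Qed.

(** [K] itself with the concatenated frames of [A] and [B] as local frames, so that
    the coordinates of a section of [K] in such a frame are known to be smooth. *)
Definition full_subbundle : subbundle (K := K).
Proof.
apply: (@Subbundle _ _ _ K (srank A + srank B) (fun m => fullv)) => m.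
have [U [e [f [Um _ _ H]]]] := cat_local_frame m.
by exists U, (fun x => [tuple of e x ++ f x]).
Defined.

Lemma proj_smooth (s : section K) :
  smooth_sec setT (fun m => daddv_pi (A m) (B m) (s m)).
Proof.
apply: smooth_sec_local => [|m _]; first exact: openT.
have [U [e [f [Um Ae Bf Cef]]]] := cat_local_frame m.
have [oU se be] := Ae; have [_ sf bf] := Bf; have [_ _ bef] := Cef.
have [j jm] := vdom_cover K m.
exists U, j; split=> // a.
pose p : sindex full_subbundle :=
  exist (fun p => local_frame full_subbundle p.1 p.2) (U, fun x => [tuple of e x ++ f x]) Cef.
have oUj : open (U `&` vdom j) by apply: openI => //; exact: vdom_open.
pose t x : subvs_of (full_subbundle x) := Subvs (memvf (s x) : s x \in full_subbundle x).
have st := sub_coord_smooth p (s := t) openT (section_smooth s).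
have H : smooth_on (U `&` vdom j) (fun x => \sum_(b < srank A)
   coord (sframe p x) (lshift _ b) (t x) * coord (vframe j x) a (tnth (e x) b)).
  apply: smooth_on_sum => // b; apply: smooth_onM => //.
    by apply: smooth_on_sub (st (lshift _ b)) => x [].
  by apply: smooth_on_sub (se b j a) => x [].
apply: smooth_on_ext H => // x [Ux jx].
pose SA := \sum_(b < srank A) coord (sframe p x) (lshift _ b) (t x) *: tnth (e x) b.
pose SB := \sum_(b < srank B) coord (sframe p x) (rshift _ b) (t x) *: tnth (f x) b.
have -> : s x = SA + SB.
  rewrite -[s x]/(vsval (t x)).
  rewrite {1}(coord_basis (sframe_basis (p := p) Ux) (memvf (t x))).
  rewrite linear_sum /= big_split_ord /=; congr (_ + _); apply: eq_bigr => b _.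
    congr (_ *: _); rewrite (nth_map 0) ?size_tuple ?(ltn_ord (lshift _ b)) // vsprojK ?memvf //.
    by rewrite nth_cat size_tuple ltn_ord -tnth_nth.
  congr (_ *: _); rewrite (nth_map 0) ?size_tuple ?(ltn_ord (rshift _ b)) // vsprojK ?memvf //.
  by rewrite nth_cat size_tuple ltnNge leq_addr /= addKn -tnth_nth.
have SAin : SA \in A x.
  rewrite /SA; apply: memv_suml => b _; apply: memvZ.
  by apply: (basis_mem (be x Ux)); exact: mem_tnth.
have SBin : SB \in B x.
  rewrite /SB; apply: memv_suml => b _; apply: memvZ.
  by apply: (basis_mem (bf x Ux)); exact: mem_tnth.
have dAB : (A x :&: B x = 0)%VS by case: (AB x).
have dBA : (B x :&: A x = 0)%VS by rewrite capvC.
rewrite linearD /= daddv_pi_id //.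
have -> : daddv_pi (A x) (B x) SB = 0.
  have SBin' : SB \in (B x + A x)%VS by rewrite (subvP (addvSl _ _)).
  by apply: (addrI SB); rewrite -{1}(daddv_pi_id dBA SBin) daddv_pi_add // addr0.
rewrite addr0 /SA linear_sum /=; apply: eq_bigr => b _.
by rewrite linearZ.
Qed.

Lemma section_decomposition (s : section K) :
  exists (a : section (sub_vbundle A)) (b : section (sub_vbundle B)),
    s = sub_inclusion a + sub_inclusion b.
Proof.
pose t : section K := MkSection (proj_smooth s).
have tA m : t m \in A m by exact: memv_pi.
have stB m : (s - t) m \in B m.
  have [sAB iAB] := AB m.
  rewrite /= -{1}[s m](daddv_pi_add (V := B m) iAB) ?sAB ?memvf //.
  by rewrite addrC addKr memv_pi.
exists (sub_section tA), (sub_section stB).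
by apply: section_ext => m /=; rewrite addrC subrK.
Qed.

End Splitting.

(** * Forms and the Cartan formula *)

Local Notation upd X i y := (fun_of_simpl [eta X with i |-> y]).

Lemma addr_cancelr (V : zmodType) (a b p r t : V) :
  a + t + r - (b + p + t) = a - b + (r - p).
Proof. by rewrite [a + t + r]addrAC opprD addrACA subrr addr0 opprD addrACA. Qed.

Lemma addr_sub_addr (V : zmodType) (a b c d : V) :
  a + b - (c + d) = a - c + (b - d).
Proof. by rewrite opprD addrACA. Qed.

Section Tuples.
Variable T : Type.

Definition ccons k (x : T) (X : 'I_k -> T) : 'I_k.+1 -> T :=
  fun i => oapp X x (unlift ord0 i).

Lemma ccons0 k x (X : 'I_k -> T) : ccons x X ord0 = x.
Proof. by rewrite /ccons unlift_none. Qed.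

Lemma cconsS k x (X : 'I_k -> T) i : ccons x X (lift ord0 i) = X i.
Proof. by rewrite /ccons liftK. Qed.

Lemma ccons_eta k (Z : 'I_k.+1 -> T) : Z = ccons (Z ord0) (fun i => Z (lift ord0 i)).
Proof.
by apply/funext => i; case: (unliftP ord0 i) => [j|] ->; rewrite ?ccons0 ?cconsS.
Qed.

Lemma upd_ccons0 k x y (X : 'I_k -> T) : 
  (upd (ccons x X) ord0 y) = ccons y X.
Proof.
by apply/funext => i /=; case: (unliftP ord0 i) => [j|] ->; rewrite ?ccons0 ?cconsS.
Qed.

Lemma upd_cconsS k x y (X : 'I_k -> T) i :
  (upd (ccons x X) (lift ord0 i) y) = ccons x (upd X i y).
Proof.
apply/funext => l /=; case: (unliftP ord0 l) => [j|] ->; rewrite ?ccons0 ?cconsS //=.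
Qed.

Lemma upd_upd k (X : 'I_k -> T) i x y :
  (upd (upd X i x) i y) = (upd X i y).
Proof. by apply/funext => l /=; case: eqP. Qed.

Lemma upd_comm k (X : 'I_k -> T) i j x y : i != j ->
  (upd (upd X i x) j y) = (upd (upd X j y) i x).
Proof.
move=> ij; apply/funext => l /=; case: eqP => // ->; case: eqP => // ji.
by rewrite ji eqxx in ij.
Qed.

Lemma upd_id k (X : 'I_k -> T) i : (upd X i (X i)) = X.
Proof. by apply/funext => l /=; case: eqP => // ->. Qed.

End Tuples.

Section Forms.
Context {R : realType} {n : nat} {M : manifold R n} {A E : vbundle M}.

Definition contract k (x : section A) (mu : cochain A E k.+1) : cochain A E k :=
  fun X => mu (ccons x X).

Lemma form_linear k (mu : cochain A E k) : is_form mu ->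
  forall X i, linear (fun Y => mu (upd X i Y)).
Proof. by case. Qed.

Lemma form_add k (mu : cochain A E k) X i Y Z : is_form mu ->
  mu (upd X i (Y + Z)) = mu (upd X i Y) + mu (upd X i Z).
Proof. by move=> /form_linear fm; have := fm X i 1 Y Z; rewrite !scale1r. Qed.

Lemma form0 k (mu : cochain A E k) X i : is_form mu -> mu (upd X i 0) = 0.
Proof. by move=> fm; apply: (addrI (mu (upd X i 0))); rewrite -form_add ?addr0. Qed.

Lemma form_scale k (mu : cochain A E k) X i (f : smooth_fun M) Y : is_form mu ->
  mu (upd X i (f *: Y)) = f *: mu (upd X i Y).
Proof.
by move=> fm; have := form_linear fm X i f Y 0; rewrite /= form0 // !addr0.
Qed.

Lemma form_swap k (mu : cochain A E k) X i j x y : is_form mu -> i != j ->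
  mu (upd (upd X i x) j y) =
  - mu (upd (upd X i y) j x).
Proof.
move=> fm ij; apply/eqP; rewrite -addr_eq0; apply/eqP.
have alt z : mu (upd (upd X i z) j z) = 0.
  by apply: (fm.2 _ i j) => //=; rewrite (negPf ij) !eqxx.
have addi z : mu (upd (upd X i (x + y)) j z) =
    mu (upd (upd X i x) j z) + mu (upd (upd X i y) j z).
  by rewrite !(upd_comm X _ z ij) form_add.
by have := alt (x + y); rewrite form_add // !addi !alt add0r addr0 addrC.
Qed.

Lemma contract_form k x (mu : cochain A E k.+1) :
  is_form mu -> is_form (contract x mu).
Proof.
move=> [lm am]; split=> [X i f Y Z|X i j ij XX].
  by rewrite /contract -!upd_cconsS lm.
by apply: (am _ (lift ord0 i) (lift ord0 j)); rewrite ?(inj_eq lift_inj) ?cconsS.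
Qed.

(** Antisymmetry in the first two slots, which follows from alternation and
    additivity there, moves any slot past the first one, where the contractions
    are known to be forms. *)
Lemma form_of_contract k (G : cochain A E k.+2) :
  (forall x, is_form (contract x G)) ->
  (forall x y X, G (ccons (x + y) X) = G (ccons x X) + G (ccons y X)) ->
  (forall x X, G (ccons x (ccons x X)) = 0) -> is_form G.
Proof.
move=> fG aG altG.
have swap x y X : G (ccons x (ccons y X)) = - G (ccons y (ccons x X)).
  apply/eqP; rewrite -addr_eq0; apply/eqP.
  have add1 z : G (ccons z (ccons (x + y) X)) =
      G (ccons z (ccons x X)) + G (ccons z (ccons y X)).
    by have := form_add (ccons x X) ord0 x y (fG z); rewrite !upd_ccons0.
  have := altG (x + y) X; rewrite aG !add1 !altG add0r addr0.
  by [].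
have alt0 x X j : x = X j -> G (ccons x X) = 0.
  rewrite (ccons_eta X); move: (X _) (fun i => X _) => y {}X.
  case: (unliftP ord0 j) => [l|] ->; last by rewrite ccons0 => ->.
  rewrite cconsS => xX; rewrite swap.
  by rewrite [G _]((fG y).2 _ ord0 (lift ord0 l)) ?oppr0 // ccons0 cconsS.
split=> [Z i f Y W|Z i j ij].
  case: (unliftP ord0 i) => [l|] ->.
    by rewrite (ccons_eta Z) !upd_cconsS; exact: (form_linear (fG _)).
  rewrite (ccons_eta Z) !upd_ccons0; move: (fun i => Z _) => X.
  rewrite (ccons_eta X); move: (X _) (fun i => X _) => y {}X.
  have := form_linear (fG y) (ccons y X) ord0 f Y W.
  by rewrite /contract !upd_ccons0 !(swap _ y) => ->; rewrite opprD scalerN.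
case: (unliftP ord0 i) ij => [i'|] ->; case: (unliftP ord0 j) => [j'|] -> ij //.
- rewrite (inj_eq lift_inj) in ij; rewrite (ccons_eta Z) !cconsS.
  exact: (fG _).2.
- by move/esym; rewrite [in G Z](ccons_eta Z); exact: alt0.
- by rewrite [in G Z](ccons_eta Z); exact: alt0.
Qed.

End Forms.

Section Cartan.
Context {R : realType} {n : nat} {M : manifold R n} {A E : vbundle M}.
Variable a : algebroid_action A E.
Hypotheses (la : is_lie_algebroid a) (ra : is_representation a).
Local Notation br := (alg_bracket a).
Local Notation rep := (alg_rep a).

Lemma RlinearD (V W : lmodType (smooth_fun M)) (F : V -> W) : Rlinear F ->
  {morph F : x y / x + y}.
Proof.
move=> lF x y; have := lF 1 x y.
have -> : smooth_cst M 1 = 1 by exact: val_inj.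
by rewrite !scale1r.
Qed.

Lemma repZ X (f : smooth_fun M) u :
  rep X (f *: u) = f *: rep X u + alg_anchor a X f *: u.
Proof. by rewrite gop_leibniz rep_anchor. Qed.

Definition lie_form X k (mu : cochain A E k) : cochain A E k := fun Y =>
  rep X (mu Y) - \sum_(j < k) mu (upd Y j (br X (Y j))).

(** The Cartan formula [i_x d mu = L_x mu - d (i_x mu)]. *)
Lemma CE_d_ccons k (mu : cochain A E k.+1) x (X : 'I_k.+1 -> section A) :
  CE_d a mu (ccons x X) = lie_form x mu X - CE_d a (contract x mu) X.
Proof.
rewrite /CE_d big_ord_recl expr0 scale1r ccons0; congr (_ + _).
  congr (rep x (mu _) - _); first by apply/funext => l; rewrite cconsS.
  rewrite big_mkcond big_ord_recl /= add0r; apply: eq_bigr => j _.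
  rewrite cconsS; congr mu; apply/funext => l; rewrite cconsS /= (inj_eq lift_inj).
  by case: eqP.
rewrite -sumrN; apply: eq_bigr => i _; rewrite exprS -scaleNr mulN1r cconsS.
have lift0 (l : 'I_k.+1) : lift (lift ord0 i) l =
    if unlift ord0 l is Some l' then lift ord0 (lift i l') else ord0.
  by case: (unliftP ord0 l) => [l'|] ->; apply: val_inj;
    rewrite /= /bump ?ltnn /= ?add1n ?ltnS ?addnS.
congr (_ *: (rep _ _ - _)).
  congr mu; apply/funext => l; rewrite lift0 {2}/ccons.
  by case: unlift => [l'|] /=; rewrite ?cconsS ?ccons0.
rewrite big_mkcond big_ord_recl /= add0r [RHS]big_mkcond; apply: eq_bigr => j _.
rewrite cconsS ltnS; case: ifP => // _; congr mu; apply/funext => l.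
rewrite lift0 {2}/ccons.
case: unlift => [l'|] /=; rewrite ?cconsS ?ccons0 ?(inj_eq lift_inj) //.
Qed.


Let brDr X : {morph br X : Y Z / Y + Z}.
Proof. exact: (RlinearD (leibniz_Rlinearr (lie_leibniz_algebra la) X)). Qed.

Let brDl Z : {morph (br ^~ Z) : X Y / X + Y}.
Proof. exact: (RlinearD (leibniz_Rlinearl (lie_leibniz_algebra la) Z)). Qed.

(** The Leibniz rules of the bracket and of the representation both produce the
    term [anchor(X)(f) mu], and the two cancel. *)
Lemma lie_form_form X k (mu : cochain A E k) : is_form mu -> is_form (lie_form X mu).
Proof.
move=> fm; split=> [Y i f V W|Y i j ij Yij]; rewrite /lie_form.
  have H j : mu (upd (upd Y i (f *: V + W)) j (br X (upd Y i (f *: V + W) j))) =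
      f *: mu (upd (upd Y i V) j (br X (upd Y i V j))) +
      mu (upd (upd Y i W) j (br X (upd Y i W j))) +
      (if j == i then alg_anchor a X f *: mu (upd Y i V) else 0).
    rewrite /=; have [->|ji] := eqVneq j i.
      rewrite !upd_upd brDr (lie_leibniz_rule la) !form_add //.
      by rewrite !form_scale // addrAC.
    rewrite eq_sym in ji; rewrite !(upd_comm Y _ _ ji) addr0.
    exact: form_linear.
  under eq_bigr do rewrite H.
  rewrite !big_split /= -scaler_sumr -big_mkcond big_pred1_eq.
  rewrite (form_linear fm) gopD repZ scalerBr.
  exact: addr_cancelr.
have z l : l != i -> l != j -> mu (upd Y l (br X (Y l))) = 0.
  move=> li lj; apply: (fm.2 _ i j ij) => /=.
  by rewrite ![_ == l]eq_sym (negPf li) (negPf lj).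
rewrite (fm.2 _ i j ij Yij) gop0 sub0r (bigD1 i) //= (bigD1 j) //= 1?eq_sym //.
rewrite big1 ?addr0 => [|l /andP[]]; last exact: z.
have := form_swap Y (Y i) (br X (Y i)) fm ij.
rewrite upd_id Yij -(upd_comm Y (Y j) _) 1?eq_sym // upd_id => ->.
by rewrite subrr oppr0.
Qed.

Lemma lie_formDl X Y k (mu : cochain A E k) Z : is_form mu ->
  lie_form (X + Y) mu Z = lie_form X mu Z + lie_form Y mu Z.
Proof.
move=> fm; rewrite /lie_form linearD /= addrACA -opprD -big_split /=.
congr (_ - _); apply: eq_bigr => j _.
by rewrite [br _ _]brDl form_add.
Qed.

Lemma CE_dD k (mu nu : cochain A E k) X :
  CE_d a (fun Y => mu Y + nu Y) X = CE_d a mu X + CE_d a nu X.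
Proof.
rewrite /CE_d -big_split; apply: eq_bigr => i _ /=.
by rewrite gopD big_split /= opprD addrACA scalerDr.
Qed.

Lemma CE_d0 k X : CE_d a (fun _ : 'I_k -> section A => 0) X = 0.
Proof.
rewrite /CE_d big1 // => i _; rewrite gop0 big1 ?subrr ?scaler0 //.
Qed.

Lemma CE_dcochain0 (mu : cochain A E 0) X Z : CE_d a mu X = rep (X ord0) (mu Z).
Proof.
rewrite /CE_d big_ord_recl big_ord0 addr0 expr0 scale1r.
rewrite big_mkcond big_ord_recl big_ord0 /= !addr0 subr0.
by congr (rep _ (mu _)); apply/funext => -[].
Qed.

(** Induction on the degree by the Cartan formula.  Alternation in the first two
    slots is [i_x L_x = L_x i_x] (from [[x, x] = 0]) together with [i_x i_x = 0]. *)
Lemma CE_d_form k (mu : cochain A E k) : is_form mu -> is_form (CE_d a mu).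
Proof.
elim: k mu => [|k IH] mu fm.
  split=> [X i f Y Z|X i j]; last by rewrite !ord1 eqxx.
  have Z0 : 'I_0 -> section A by case.
  by rewrite !(CE_dcochain0 _ _ Z0) (ord1 i) /= linearP.
apply: form_of_contract => [x|x y X|x X].
- split=> [X i f Y Z|X i j ij Xij].
    rewrite /contract !CE_d_ccons (form_linear (lie_form_form x fm)).
    rewrite (form_linear (IH _ (contract_form x fm))).
    by rewrite [f *: (_ - CE_d _ _ _)]scalerBr; exact: addr_sub_addr.
  rewrite /contract CE_d_ccons ((lie_form_form x fm).2 _ i j) //.
  by rewrite ((IH _ (contract_form x fm)).2 _ i j) // subrr.
- rewrite !CE_d_ccons lie_formDl // -[RHS]addr_sub_addr -CE_dD.
  congr (_ - CE_d _ _ _); apply/funext => Y; rewrite /contract.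
  by have := form_add (ccons x Y) ord0 x y fm; rewrite !upd_ccons0.
rewrite CE_d_ccons.
have -> : lie_form x mu (ccons x X) = lie_form x (contract x mu) X.
  rewrite /lie_form big_ord_recl upd_ccons0 ccons0 (lie_alternating la).
  have -> : mu (ccons 0 X) = 0.
    by have := form0 (ccons 0 X) ord0 fm; rewrite upd_ccons0.
  rewrite add0r; congr (_ - _); apply: eq_bigr => j _.
  by rewrite upd_cconsS cconsS.
case: k IH mu fm X => [|k] IH mu fm X.
  rewrite /lie_form big_ord0 subr0 (CE_dcochain0 _ _ X) ccons0.
  exact: subrr.
rewrite CE_d_ccons (_ : contract x (contract x mu) = fun=> 0) ?CE_d0 ?subr0 ?subrr //.
apply/funext => Y; apply: (fm.2 _ ord0 (lift ord0 ord0)) => //.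
by rewrite cconsS !ccons0.
Qed.

Section Invariance.
Context {B : vbundle M} (P : pairing A B E).

(** The forms of degree one that belong to [B]. *)
Definition paired (F : section A -> section E) :=
  exists xi : section B, forall Y, F Y = psec P Y xi.

Lemma paired0 : paired (fun=> 0).
Proof. by exists 0 => Y; rewrite (linearf0 (psec_linearr P Y)). Qed.

Lemma pairedB F G : paired F -> paired G -> paired (fun Y => F Y - G Y).
Proof.
move=> [xi Fxi] [eta Geta]; exists (xi - eta) => Y.
by rewrite Fxi Geta (linearfB _ _ (psec_linearr P Y)).
Qed.

Lemma paired_sum k (F : 'I_k -> section A -> section E) : (forall i, paired (F i)) ->
  paired (fun Y => \sum_(i < k) F i Y).
Proof.
move=> FP; have [xi Fxi] := choice FP; exists (\sum_(i < k) xi i) => Y.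
rewrite (eq_bigr (fun i => psec P Y (xi i))) => [|i _]; last exact: Fxi.
apply/esym; apply: (big_ind2 (fun x y => psec P Y x = y)) => //.
- exact: linearf0 (psec_linearr P Y).
- by move=> x1 x2 y1 y2 <- <-; exact: linearfD (psec_linearr P Y).
Qed.

Hypothesis pd0 : forall u, paired (fun Y => rep Y u).
Hypothesis pd1 : forall X xi,
  paired (fun Y => rep X (psec P Y xi) - psec P (br X Y) xi).

(** The bracket with the last argument [Z] combines with [rep X] into the Lie
    derivative of the section of [B] that represents the form; the other terms
    have [Z] as a bare last argument. *)
Lemma lie_form_paired X k (mu : cochain A E k) (i : 'I_k) Y : is_form_in P mu -> i.+1 = k :> nat ->
  paired (fun Z => lie_form X mu (upd Y i Z)).
Proof.
move=> [fm pm] ik; rewrite /lie_form.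
have [xi muxi] := pm i ik Y.
have [eta etaP] := pd1 X xi.
have pj j : paired (fun Z => if j == i then 0 else mu (upd (upd Y i Z) j (br X (Y j)))).
  case: (eqVneq j i) => [_|ji]; first exact: paired0.
  have [zeta zP] := pm i ik (upd Y j (br X (Y j))).
  by exists zeta => Z; rewrite -zP upd_comm // eq_sym.
have [zeta zP] := paired_sum pj.
have [th thP] : paired (fun Z => rep X (psec P Z xi) - psec P (br X Z) xi -
   \sum_(j < k) (if j == i then 0 else mu (upd (upd Y i Z) j (br X (Y j))))).
  by apply: pairedB => //; exists zeta.
exists th => Z; rewrite -thP muxi [in LHS](bigD1 i) //= upd_upd eqxx muxi opprD addrA.
congr (_ - _); rewrite big_mkcond; apply: eq_bigr => j _ /=.
by case: eqP.
Qed.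

(** It suffices to know that [d u] and the Lie derivatives of sections of [B] are
    given by sections of [B]: the Cartan formula reduces all degrees to these. *)
Lemma invariant_of_paired : invariant_action P a.
Proof.
move=> k mu pm; split; first by apply: CE_d_form; case: pm.
elim: k mu pm => [|k IH] mu pm i ik X.
  have Z0 : 'I_0 -> section A by case.
  have [xi xiP] := pd0 (mu Z0); exists xi => Y; rewrite -xiP (CE_dcochain0 _ _ Z0).
  by rewrite (ord1 i).
case: (unliftP ord0 i) ik => [j|] -> // jk.
have {}jk : j.+1 = k.+1 := congr1 predn jk.
rewrite (ccons_eta X); move: (X _) (fun i => X _) => x {}X.
have cm : is_form_in P (contract x mu).
  split=> [|l lk Y]; first by apply: contract_form; case: pm.
  have [xi xiP] := pm.2 (lift ord0 l) (congr1 S lk) (ccons x Y).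
  by exists xi => Z; rewrite -xiP upd_cconsS.
have [th thP] : paired (fun Z => lie_form x mu (upd X j Z) - CE_d a (contract x mu) (upd X j Z)).
  by apply: pairedB; [exact: (lie_form_paired _ _ pm)|exact: IH].
by exists th => Z; rewrite upd_cconsS CE_d_ccons; exact: thP.
Qed.

End Invariance.

End Cartan.

(** * Courant algebroids *)

Lemma double_sub_eq (V : zmodType) (p q r w : V) : p - q - r = - w ->
  p + p - (q + q) - (r + r) = - (w + w).
Proof. by move=> H; rewrite (addr_sub_addr p) addr_sub_addr H opprD. Qed.

Lemma oppr_double_sub (V : zmodType) (p q r : V) :
  - (p + p) - (- (q + q) + - (r + r)) = - (p - (q + r) + (p - (q + r))).
Proof. by rewrite -!opprD -addr_sub_addr; congr (- (_ - _)); rewrite addrACA. Qed.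

Lemma oppr_double_cancel (V : zmodType) (p q r : V) :
  - (p - q + (p - q)) = - (p + r + (p + r)) - - (q + r + (q + r)).
Proof.
rewrite -opprD; congr (- _); rewrite addr_sub_addr; congr (_ + _);
by rewrite opprD addrACA subrr addr0.
Qed.

Lemma addr_cancel_mid (V : zmodType) (p x y z : V) :
  p + (x + y) - (- z + x) = p + (y + z).
Proof. by rewrite opprD opprK [x + y]addrC addrACA addrK -addrA [z + y]addrC. Qed.

Section Courant.
Context {R : realType} {n : nat} {M : manifold R n} {E K : vbundle M}.
Variables (P : pairing K K E) (br : section K -> section K -> section K).
Variable rho : {linear section K -> gauge_sec E}.
Hypothesis hK : is_E_courant P br rho.
Local Notation pr := (psec P).
Local Notation half := (smooth_cst M 2^-1).

Lemma half_double (V : vbundle M) (s : section V) : half *: s + half *: s = s.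
Proof.
apply: section_ext => m /=; rewrite -scalerDl.
have -> : 2^-1 + 2^-1 = 1 :> R by rewrite [RHS](splitr 1) mul1r.
by rewrite scale1r.
Qed.

Lemma gop_half (d : gauge_sec E) u : d (half *: u) = half *: d u.
Proof. by have := gop_Rlinear d 2^-1 u 0; rewrite gop0 !addr0. Qed.

Lemma prC X Y : pr X Y = pr Y X.
Proof. by apply: section_ext => m; exact: (courant_symmetric hK). Qed.

Lemma prDl X X' Y : pr (X + X') Y = pr X Y + pr X' Y.
Proof. exact: linearfD (psec_linearl P Y). Qed.

Lemma prDr X Y Y' : pr X (Y + Y') = pr X Y + pr X Y'.
Proof. exact: linearfD (psec_linearr P X). Qed.

Lemma brDl X X' Y : br (X + X') Y = br X Y + br X' Y.
Proof. exact: (RlinearD (leibniz_Rlinearl (courant_leibniz hK) Y)). Qed.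

Lemma brDr X Y Y' : br X (Y + Y') = br X Y + br X Y'.
Proof. exact: (RlinearD (leibniz_Rlinearr (courant_leibniz hK) X)). Qed.

Lemma pr_inj X X' : (forall Y, pr X Y = pr X' Y) -> X = X'.
Proof. exact: psec_injl (courant_nondegenerate hK). Qed.

(** [X] represents [D u = rho^* (d u)]. *)
Definition is_D u X := is_rho_star P rho (jet_d u) X.

Lemma D_exists u : exists X, is_D u X.
Proof. exact: (courant_EC4 hK (is_jet_d u)). Qed.

Lemma rho_D u X : is_D u X -> rho X = 0.
Proof. exact: (courant_EC5 hK (is_jet_d u)). Qed.

(** By (EC-3), [([Y, X], Z) = rho(Y)(X, Z) - (X, [Y, Z])], which is half of
    [rho(Y) rho(Z) u - rho([Y, Z]) u = rho(Z) rho(Y) u]. *)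
Lemma bracket_D u X Y : is_D u X -> is_D (rho Y u) (br Y X).
Proof.
move=> DX Z; have /eqP := courant_EC3 hK Y X Z.
rewrite -subr_eq => /eqP <-; rewrite !DX gop_half -scalerBr /jet_d.
by rewrite (courant_EC1 hK) /= subKr.
Qed.

(** Polarization of (EC-2). *)
Lemma bracket_sym X Y : is_D (pr X Y + pr Y X) (br X Y + br Y X).
Proof.
move=> Z; have := courant_EC2 hK (X + Y) Z.
rewrite !brDl !brDr !prDl !prDr /= /jet_d !gopD !scalerDr.
rewrite (courant_EC2 hK X) (courant_EC2 hK Y) /= /jet_d => H.
apply: (addrI (half *: rho Z (pr X X))); apply: (addIr (half *: rho Z (pr Y Y))).
by move: H; rewrite !addrA.
Qed.

(** [[X, Y] + [Y, X]] is [D] of [2 (X, Y) = rho(Y) u], and so is [[Y, X]]. *)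
Lemma D_central u X Y : is_D u X -> br X Y = 0.
Proof.
move=> DX; apply: pr_inj => Z; rewrite (linearf0 (psec_linearl P Z)).
apply: (addIr (pr (br Y X) Z)); rewrite add0r -prDl bracket_sym /jet_d [pr Y X]prC.
by rewrite DX half_double (bracket_D Y DX).
Qed.

(** Apply (EC-3) to [(f Y, Z) = f (Y, Z)]. *)
Lemma br_leibniz_rule X (f : smooth_fun M) Y :
  br X (f *: Y) = f *: br X Y + gsym (rho X) f *: Y.
Proof.
apply: pr_inj => Z; have := courant_EC3 hK X (f *: Y) Z.
have prZl g T : pr (g *: T) Z = g *: pr T Z.
  by rewrite -[g *: T]addr0 (psec_linearl P Z) (linearf0 (psec_linearl P Z)) addr0.
have prZl' T : pr (f *: Y) T = f *: pr Y T.
  by rewrite -[f *: Y]addr0 (psec_linearl P T) (linearf0 (psec_linearl P T)) addr0.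
rewrite !prZl' gop_leibniz (courant_EC3 hK) prDl !prZl scalerDr.
rewrite addrAC => H; apply: (addIr (f *: pr Y (br X Z))).
by rewrite H.
Qed.

(** * Dirac structures as Lie algebroids *)

Section Dirac.
Variables (L : subbundle (K := K)) (hL : is_dirac P br L).
Local Notation a := (dirac_algebroid rho hL).
Local Notation inc := (@sub_inclusion _ _ _ _ L).

Lemma inc_inj : injective inc.
Proof.
move=> X Y XY; apply: section_ext => m; apply: val_inj.
by have := congr1 (fun s : section K => s m) XY.
Qed.

Lemma incP f X Y : inc (f *: X + Y) = f *: inc X + inc Y.
Proof. exact: section_ext. Qed.

Lemma incD X Y : inc (X + Y) = inc X + inc Y.
Proof. exact: section_ext. Qed.

Lemma inc0 : inc 0 = 0.
Proof. exact: section_ext. Qed.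

Lemma inc_bracket X Y : inc (alg_bracket a X Y) = br (inc X) (inc Y).
Proof. exact: section_ext. Qed.

Lemma dirac_isotropic X Y : pr (inc X) (inc Y) = 0.
Proof.
apply: section_ext => m /=.
by apply: ((dirac_perp hL (vsval (X m))).1 (subvsP _)); exact: subvsP.
Qed.

Lemma dirac_lie_algebroid : is_lie_algebroid a.
Proof.
have lK := courant_leibniz hK.
split.
- split.
  + move=> Y r X X'; apply: inc_inj; rewrite incP !inc_bracket incP.
    exact: (leibniz_Rlinearl lK).
  + move=> Y r X X'; apply: inc_inj; rewrite incP !inc_bracket incP.
    exact: (leibniz_Rlinearr lK).
  + move=> X Y Z; apply: inc_inj; rewrite incD !inc_bracket.
    exact: (leibniz_identity lK).
- move=> X; apply: inc_inj; rewrite inc0 inc_bracket; apply: pr_inj => Z.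
  rewrite (courant_EC2 hK) /= /jet_d dirac_isotropic gop0 scaler0.
  by rewrite (linearf0 (psec_linearl P Z)).
- move=> X f Y; apply: inc_inj; rewrite incP !inc_bracket.
  have -> : inc (f *: Y) = f *: inc Y by exact: section_ext.
  rewrite br_leibniz_rule; congr (_ + _); exact: section_ext.
- move=> X Y; have := congr1 (@gsym _ _ _ E) (courant_EC1 hK (inc X) (inc Y)).
  by rewrite -inc_bracket.
Qed.

Lemma dirac_representation : is_representation a.
Proof.
split=> // X Y; have := courant_EC1 hK (inc X) (inc Y).
by rewrite -inc_bracket.
Qed.

End Dirac.

(** * Duality between transverse Dirac structures *)

Section Transverse.
Variables (A B : subbundle (K := K)).
Hypotheses (hA : is_dirac P br A) (hB : is_dirac P br B).
Hypothesis (hAB : forall m : M, (A m + B m)%VS = fullv /\ (A m :&: B m)%VS = 0%VS).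
Variable Q : pairing (sub_vbundle A) (sub_vbundle B) E.
Local Notation iA := (@sub_inclusion _ _ _ _ A).
Local Notation iB := (@sub_inclusion _ _ _ _ B).
(* Only these properties of the duality pairing are kept, so that the results also
   apply with A and B exchanged, to the flipped pairing. *)
Hypothesis hQ : forall X xi, psec Q X xi = pr (iA X) (iB xi) + pr (iA X) (iB xi).
Hypothesis ndQ : nondegenerate Q.
Local Notation a := (dirac_algebroid rho hA).

Lemma pr_split Y X xi : pr (iA Y) (iA X + iB xi) = pr (iA Y) (iB xi).
Proof. by rewrite prDr (dirac_isotropic hA) add0r. Qed.

(** [A] being isotropic, pairing [D u] with [A] only sees the [B]-component. *)
Lemma D_component u X xi : is_D u (iA X + iB xi) ->
  forall Y, psec Q Y xi = alg_rep a Y u.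
Proof.
move=> DX Y; rewrite hQ -(pr_split Y X) prC DX /jet_d.
exact: half_double.
Qed.

(** This is (EC-3) for [(Y, xi)], with the [A]-component of [[X, xi]] killed by the
    isotropy of [A]. *)
Lemma bracket_component X xi Z eta : br (iA X) (iB xi) = iA Z + iB eta ->
  forall Y, psec Q Y eta =
    alg_rep a X (psec Q Y xi) - psec Q (alg_bracket a X Y) xi.
Proof.
move=> bE Y; rewrite !hQ inc_bracket -(pr_split Y Z) -bE gopD.
rewrite -[alg_rep a X]/(rho (iA X)).
rewrite !(courant_EC3 hK (iA X)) addr_sub_addr.
by rewrite ![pr _ _ + pr _ _]addrC !addrK.
Qed.

Lemma dirac_invariant : invariant_action Q a.
Proof.
apply: invariant_of_paired.
- exact: dirac_lie_algebroid.
- exact: dirac_representation.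
- move=> u; have [X DX] := D_exists u; have [Y [xi E1]] := section_decomposition hAB X.
  by exists xi => Z; rewrite (D_component (u := u) (X := Y)) // -E1.
- move=> X xi; have [Y [eta E1]] := section_decomposition hAB (br (iA X) (iB xi)).
  by exists eta => Z; rewrite (bracket_component E1).
Qed.

Lemma d_secE u X xi : is_D u (iA X + iB xi) -> d_sec Q a u = xi.
Proof.
move=> /D_component H; apply: xget_unique => [|eta H2].
  apply/funext => Y; rewrite /cochain1 (CE_dcochain0 _ _ _ (fun i : 'I_0 => 0)).
  exact: H.
apply: (psec_injr ndQ) => Y; rewrite H.
have := congr1 (fun F => F (fun _ => Y)) H2.
by rewrite /cochain1 (CE_dcochain0 _ _ _ (fun i : 'I_0 => 0)).
Qed.

Lemma lie_dualE X xi Z eta : br (iA X) (iB xi) = iA Z + iB eta ->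
  lie_dual Q a X xi = eta.
Proof.
move=> /bracket_component H; apply: xget_unique => [|th H2]; first exact: H.
by apply: (psec_injr ndQ) => Y; rewrite H H2.
Qed.

End Transverse.

Lemma CE_d_cochain1 (L : subbundle (K := K)) (hL : is_dirac P br L)
    (a := dirac_algebroid rho hL) (mu : cochain (sub_vbundle L) E 1) X :
  CE_d a mu X = alg_rep a (X ord0) (mu (fun _ => X ord_max))
    - mu (fun _ => alg_bracket a (X ord0) (X ord_max))
    - alg_rep a (X ord_max) (mu (fun _ => X ord0)).
Proof.
have E1 x (Y : 'I_1 -> section (sub_vbundle L)) : (fun _ => x) = ccons x (fun i : 'I_0 => Y ord0).
  by apply/funext => i; rewrite (ord1 i) ccons0.
have -> : X = ccons (X ord0) (fun _ => X ord_max).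
  apply/funext => i; case: (unliftP ord0 i) => [j|] ->; rewrite ?ccons0 ?cconsS //.
  by congr X; apply: val_inj; rewrite (ord1 j).
have mx : ord_max = lift ord0 ord0 :> 'I_2 by exact: val_inj.
rewrite CE_d_ccons mx !cconsS !ccons0 -mx /lie_form big_ord_recl big_ord0 addr0.
rewrite (CE_dcochain0 _ _ _ (fun i : 'I_0 => 0)); congr (_ - mu _ - rho _ (mu _)).
  by apply/funext => i /=; rewrite (ord1 i).
by apply/funext => i; rewrite (ord1 i) ccons0.
Qed.

(** * The cocycle condition *)

Section Cocycle.
Variables (A B : subbundle (K := K)).
Hypotheses (hA : is_dirac P br A) (hB : is_dirac P br B).
Hypothesis (hAB : forall m : M, (A m + B m)%VS = fullv /\ (A m :&: B m)%VS = 0%VS).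
Variable Q : pairing (sub_vbundle A) (sub_vbundle B) E.
Local Notation iA := (@sub_inclusion _ _ _ _ A).
Local Notation iB := (@sub_inclusion _ _ _ _ B).
Hypothesis hQ : forall X xi, psec Q X xi = pr (iA X) (iB xi) + pr (iA X) (iB xi).
Hypothesis ndQ : nondegenerate Q.
Local Notation a := (dirac_algebroid rho hA).
Local Notation b := (dirac_algebroid rho hB).

Definition bracket_pairing Y xi eta := pr (br (iA Y) (iB xi)) (iB eta).

(** [rho(eta)(Y, xi)] is the pairing of [eta] with [[xi, Y] + [Y, xi]], whose part
    [([xi, Y], eta)] cancels against (EC-3) for [rho(xi)(Y, eta)]. *)
Lemma CE_d_cochain1_bracket Y (xi : 'I_2 -> section (sub_vbundle B)) :
  CE_d b (cochain1 (pflip Q) Y) xi =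
  - (bracket_pairing Y (xi ord0) (xi ord_max)
     + bracket_pairing Y (xi ord0) (xi ord_max)).
Proof.
rewrite CE_d_cochain1 /cochain1.
have fl eta : psec (pflip Q) eta Y = pr (iA Y) (iB eta) + pr (iA Y) (iB eta).
  by rewrite -hQ; exact: section_ext.
rewrite !fl !gopD inc_bracket.
set x := iB (xi ord0); set y := iB (xi ord_max).
have H : rho x (pr (iA Y) y) - pr (iA Y) (br x y) - rho y (pr (iA Y) x) =
    - bracket_pairing Y (xi ord0) (xi ord_max).
  have -> : rho y (pr (iA Y) x) = pr (br x (iA Y)) y + bracket_pairing Y (xi ord0) (xi ord_max).
    rewrite -[RHS]prDl bracket_sym /= /jet_d [pr x _]prC gopD scalerDr.
    by rewrite half_double.
  by rewrite (courant_EC3 hK) addrK opprD addrA subrr add0r.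
exact: double_sub_eq.
Qed.

(** The last summand of the right-hand side is invariant under exchanging [X] and
    [Y], so it disappears from the difference of two Lie derivatives. *)
Lemma lie_bracket_pairing X Y xi eta al be ga de al' be' ga' de' :
  br (iA X) (iB xi) = iA al + iB ga -> br (iA X) (iB eta) = iA be + iB de ->
  br (iA Y) (iB xi) = iA al' + iB ga' -> br (iA Y) (iB eta) = iA be' + iB de' ->
  rho (iA X) (bracket_pairing Y xi eta) - (bracket_pairing Y ga eta + bracket_pairing Y xi de) =
  pr (br (iA X) (br (iA Y) (iB xi))) (iB eta) +
  (pr (iA be) (iB ga') + pr (iA be') (iB ga)).
Proof.
move=> Xxi Xeta Yxi Yeta.
have -> : bracket_pairing Y ga eta = - pr (iA be') (iB ga).
  apply/eqP; rewrite -addr_eq0; apply/eqP.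
  have := courant_EC3 hK (iA Y) (iB ga) (iB eta).
  rewrite (dirac_isotropic hB) gop0 Yeta prDr (dirac_isotropic hB) addr0.
  by rewrite [pr (iB ga) _]prC.
have -> : bracket_pairing Y xi de = pr (iA al') (iB de).
  by rewrite /bracket_pairing Yxi prDl (dirac_isotropic hB) addr0.
rewrite {1}/bracket_pairing (courant_EC3 hK) Xeta {2}Yxi !prDl !prDr.
rewrite (dirac_isotropic hA) (dirac_isotropic hB) add0r addr0 [pr (iB ga') _]prC.
exact: addr_cancel_mid.
Qed.

Lemma cocycle X Y (xi : 'I_2 -> section (sub_vbundle B)) :
  CE_d b (cochain1 (pflip Q) (alg_bracket a X Y)) xi =
    lie_cochain Q a X (CE_d b (cochain1 (pflip Q) Y)) xi -
    lie_cochain Q a Y (CE_d b (cochain1 (pflip Q) X)) xi.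
Proof.
have [al [ga Xxi]] := section_decomposition hAB (br (iA X) (iB (xi ord0))).
have [be [de Xeta]] := section_decomposition hAB (br (iA X) (iB (xi ord_max))).
have [al' [ga' Yxi]] := section_decomposition hAB (br (iA Y) (iB (xi ord0))).
have [be' [de' Yeta]] := section_decomposition hAB (br (iA Y) (iB (xi ord_max))).
have := lie_bracket_pairing Yxi Yeta Xxi Xeta; have := lie_bracket_pairing Xxi Xeta Yxi Yeta.
have LE Z V ze th : lie_dual Q a Z (xi ord0) = ze -> lie_dual Q a Z (xi ord_max) = th ->
    lie_cochain Q a Z (CE_d b (cochain1 (pflip Q) V)) xi =
    - ((rho (iA Z) (bracket_pairing V (xi ord0) (xi ord_max)) -
        (bracket_pairing V ze (xi ord_max) + bracket_pairing V (xi ord0) th)) +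
       (rho (iA Z) (bracket_pairing V (xi ord0) (xi ord_max)) -
        (bracket_pairing V ze (xi ord_max) + bracket_pairing V (xi ord0) th))).
  move=> zE tE; rewrite /lie_cochain !big_ord_recl big_ord0 addr0 !CE_d_cochain1_bracket /=.
  have mx : lift ord0 ord0 = ord_max :> 'I_2 by exact: val_inj.
  rewrite mx zE tE gopN gopD.
  exact: oppr_double_sub.
have dual := lie_dualE hA hQ ndQ.
rewrite (LE X Y ga de (dual _ _ _ _ Xxi) (dual _ _ _ _ Xeta)).
rewrite (LE Y X ga' de' (dual _ _ _ _ Yxi) (dual _ _ _ _ Yeta)).
move=> -> ->; rewrite CE_d_cochain1_bracket /bracket_pairing inc_bracket.
have -> : pr (br (br (iA X) (iA Y)) (iB (xi ord0))) (iB (xi ord_max)) =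
  pr (br (iA X) (br (iA Y) (iB (xi ord0)))) (iB (xi ord_max)) - 
  pr (br (iA Y) (br (iA X) (iB (xi ord0)))) (iB (xi ord_max)).
  by rewrite (leibniz_identity (courant_leibniz hK) (iA X)) prDl addrK.
rewrite [pr (iA be') _ + _]addrC; exact: oppr_double_cancel.
Qed.

End Cocycle.

(** * The bialgebroid *)

(** A vector of [A] orthogonal to [B] lies in [B], as [B] is its own orthogonal. *)
Lemma dual_pairing_nondegenerate (A B : subbundle (K := K)) :
  is_dirac P br A -> is_dirac P br B ->
  (forall m : M, (A m :&: B m)%VS = 0%VS) -> nondegenerate (dual_pairing P A B).
Proof.
move=> hA hB AB0.
have two0 : 2 != 0 :> R by rewrite pnatr_eq0.
split=> m v v0; apply: val_inj; apply/eqP; rewrite -memv0 -(AB0 m) memv_cap subvsP ?andbT /=.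
- apply/(dirac_perp hB) => l lB; have /eqP := v0 (Subvs lB).
  by rewrite /= scaler_eq0 (negPf two0) => /eqP.
- apply/(dirac_perp hA) => l lA; have /eqP := v0 (Subvs lA).
  by rewrite /= scaler_eq0 (negPf two0) (courant_symmetric hK) => /eqP.
Qed.

End Courant.

Theorem theorem7p5 (R : realType) (n : nat) (M : manifold R n)
    (E K : vbundle M) (P : pairing K K E)
    (br : section K -> section K -> section K)
    (rho : {linear section K -> gauge_sec E})
    (hK : is_E_courant P br rho)
    (A B : subbundle (K := K))
    (hA : is_dirac P br A) (hB : is_dirac P br B)
    (hAB : forall m : M, (A m + B m)%VS = fullv /\ (A m :&: B m)%VS = 0%VS) :
  is_E_lie_bialgebroid (dual_pairing P A B)
    (dirac_algebroid rho hA) (dirac_algebroid rho hB).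
Proof.
have hBA m : (B m + A m)%VS = fullv /\ (B m :&: A m)%VS = 0%VS.
  by rewrite addvC capvC.
have ndQ := dual_pairing_nondegenerate hK hA hB (fun m => proj2 (hAB m)).
have hQ X xi : psec (dual_pairing P A B) X xi =
    psec P (sub_inclusion X) (sub_inclusion xi) + psec P (sub_inclusion X) (sub_inclusion xi).
  by apply: section_ext => m /=; rewrite scaler_nat mulr2n.
have hQ' xi X : psec (pflip (dual_pairing P A B)) xi X =
    psec P (sub_inclusion xi) (sub_inclusion X) + psec P (sub_inclusion xi) (sub_inclusion X).
  by rewrite (prC hK) -hQ; exact: section_ext.
have ndQ' := nondegenerate_pflip ndQ.
(* D u is the sum of d^B u, in A, and of d^A u, in B. *)
have D_split u : exists X xi, is_D P rho u (sub_inclusion X + sub_inclusion xi) /\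
    (d_sec (dual_pairing P A B) (dirac_algebroid rho hA) u = xi /\
     d_sec (pflip (dual_pairing P A B)) (dirac_algebroid rho hB) u = X).
  have [D DD] := D_exists hK u; have [X [xi E1]] := section_decomposition hAB D.
  rewrite {}E1 in DD; exists X, xi; do 2!split=> //.
    exact: (d_secE hK hA hQ ndQ DD).
  by apply: (d_secE hK hB hQ' ndQ' (X := xi)); rewrite addrC.
split.
- split=> //.
  + exact: dirac_lie_algebroid.
  + exact: dirac_lie_algebroid.
  + exact: dirac_representation.
  + exact: dirac_representation.
  + exact: (dirac_invariant hK hA hAB hQ).
  + exact: (dirac_invariant hK hB hBA hQ').
- exact: (cocycle hK hA hB hAB hQ ndQ).
- move=> u X; have [Z [xi [DD [-> ->]]]] := D_split u.
  (* As [D u, X] = 0, the bracket [xi, X] lies in A, with no B-component. *)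
  apply: (lie_dualE hK hB hQ' ndQ' (Z := 0)).
  rewrite inc0 add0r; apply: (addrI (br (sub_inclusion Z) (sub_inclusion X))).
  rewrite -(brDl hK) (D_central hK _ DD) linearN -(inc_bracket rho hA).
  exact/esym/subrr.
- move=> u; have [Z [xi [DD [-> ->]]]] := D_split u.
  have -> : psec (dual_pairing P A B) Z xi =
      psec P (sub_inclusion Z + sub_inclusion xi) (sub_inclusion Z + sub_inclusion xi).
    rewrite hQ !(prDl, prDr) !(dirac_isotropic hA, dirac_isotropic hB) add0r addr0.
    by rewrite [psec P (sub_inclusion xi) _](prC hK).
  by rewrite DD (rho_D hK DD) /= scaler0.
Qed.
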